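(* Let $C$ be the cost Hamiltonian of a cost function $c:\{0,1\}^n\to\mathbb{R}$ and let $p\ge1$. For QAOA$_p$, to fifth order in the angles $\gamma_1,\beta_1,\dots,\gamma_p,\beta_p$ we have $$\begin{aligned}\langle C\rangle_p=\ \langle C\rangle_0&-\langle\nabla_C\nabla C\rangle_0\sum_{i\le j}\gamma_i\beta_j\\ &+\langle\nabla_C\nabla^3C\rangle_0\Big(\sum_{i\le j<k<l}\gamma_i\beta_j\beta_k\beta_l+\tfrac12\sum_{i\le j<k}\gamma_i(\beta_j^2\beta_k+\beta_j\beta_k^2)+\tfrac1{3!}\sum_{i\le j}\gamma_i\beta_j^3\Big)\\ &+\langle\nabla_C^3\nabla C\rangle_0\Big(\sum_{i<j<k\le l}\gamma_i\gamma_j\gamma_k\beta_l+\tfrac12\sum_{j<k\le l}(\gamma_j^2\gamma_k+\gamma_j\gamma_k^2)\beta_l+\tfrac1{3!}\sum_{i\le j}\gamma_i^3\beta_j\Big)\\ &+\langle\nabla_C^2\nabla^2C\rangle_0\Big(\sum_{i<j\le k<l}\gamma_i\gamma_j\beta_k\beta_l+\tfrac12\sum_{i\le k<l}\gamma_i^2\beta_k\beta_l+\tfrac12\sum_{i<j\le k}\gamma_i\gamma_j\beta_k^2\\ &\qquad\qquad\qquad\quad+\tfrac14\sum_{i\le j}\gamma_i^2\beta_j^2+\sum_{i\le j<k\le l}\gamma_i\beta_j\gamma_k\beta_l\Big)+\cdots\end{aligned}$$ where all indices range over $\{1,\dots,p\}$ and the terms not shown are each of order six or higher in the angles (and in the gradient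 operator expectations appearing as their coefficients).
   Context: Work on $n$ qubits with computational basis $\{|x\rangle : x\in\{0,1\}^n\}$. The cost Hamiltonian is $C=\sum_x c(x)|x\rangle\langle x|$, $B=\sum_{j=1}^nX_j$, $|s\rangle=2^{-n/2}\sum_x|x\rangle$. The superoperators are $\nabla A=[B,A]$ and $\nabla_CA=[C,A]$, powers denoting iteration; the order of an iterated commutator $\nabla_C^{a}\nabla^{b}\cdots C$ is the total number of $\nabla$'s and $\nabla_C$'s. $\langle A\rangle_0=\langle s|A|s\rangle$. The QAOA$_p$ state is $e^{-i\beta_pB}e^{-i\gamma_pC}\cdots e^{-i\beta_1B}e^{-i\gamma_1C}|s\rangle$ with real angles, and $\langle C\rangle_p$ is the expectation value of $C$ in this state, viewed as a power series in the $2p$ angles. *)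

(* Defs.v *)
(* MathComp / MathComp-Analysis. *)
From mathcomp Require Import all_boot all_order all_algebra.
From mathcomp Require Import all_classical all_reals all_analysis.
From mathcomp.real_closed Require Export complex.
Set Implicit Arguments.
Unset Strict Implicit.
Unset Printing Implicit Defensive.
Import Order.TTheory GRing.Theory Num.Theory numFieldNormedType.Exports.
Local Open Scope classical_set_scope.
Local Open Scope sesquilinear_scope.
Local Open Scope ring_scope.
Local Open Scope complex_scope.

(* The limit is taken entrywise, in the topology of the norm of [K]; below,
   [K] is instantiated with R[i]. *)
Definition expmx (K : numFieldType) (N : nat) (A : 'M[K]_N) : 'M[K]_N :=
  \matrix_(i, j) lim (series (fun k => (A ^+ k) i j / k`!%:R) @ \oo).

Section MultivariatePowerSeries.
Variables (K : numFieldType) (I : finType).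
Implicit Types (a : (I -> nat) -> K) (t : I -> K).

Definition mdegree (m : I -> nat) : nat := \sum_i m i.

(* A multi-index of total degree d has all its exponents at most d. *)
Definition homogeneous_part a t (d : nat) : K :=
  \sum_(m : {ffun I -> 'I_d.+1} | mdegree (fun i => m i) == d)
     a (fun i => m i) * \prod_i t i ^+ m i.

(* The first conjunct is absolute convergence of the family of all monomials
   a_m t^m, so grouping them by degree in the second one is immaterial. *)
Definition mpseries_sums_to a t (s : K) : Prop :=
  cvg (series (homogeneous_part (fun m => `|a m|) (fun i => `|t i|)) @ \oo) /\
  series (homogeneous_part a t) @ \oo --> s.

End MultivariatePowerSeries.

Section Qubits.
Variables (R : realType) (n : nat).

Definition bits := {ffun 'I_n -> bool}.

(* Basis vectors are numbered by the enumeration of the finite type [bits]. *)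
Definition state := 'cV[R[i]]_#|{: bits}|.
Definition operator := 'M[R[i]]_#|{: bits}|.

Definition ket (x : bits) : state := delta_mx (enum_rank x) 0.

Definition ketbra (x y : bits) : operator := ket x *m (ket y)^t*.

Definition flip (j : 'I_n) (x : bits) : bits :=
  [ffun k => if k == j then ~~ x k else x k].

Definition pauliX (j : 'I_n) : operator := \sum_(x : bits) ketbra (flip j x) x.

Definition mixer : operator := \sum_j pauliX j.

Definition costH (c : bits -> R) : operator :=
  \sum_(x : bits) (c x)%:C *: ketbra x x.

Definition uniform_state : state :=
  ((Num.sqrt (2 ^+ n))^-1)%:C *: \sum_(x : bits) ket x.

Definition expectation (psi : state) (A : operator) : R[i] :=
  (psi^t* *m A *m psi) 0 0.

Definition expect0 (A : operator) : R[i] := expectation uniform_state A.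

Definition commutator (A B : operator) : operator := A *m B - B *m A.

Definition nabla (A : operator) : operator := commutator mixer A.

Definition nablaC (c : bits -> R) (A : operator) : operator :=
  commutator (costH c) A.

(* Layer 0 acts first: [enum 'I_p] is increasing. *)
Definition qaoa_state (p : nat) (c : bits -> R) (gamma beta : 'I_p -> R) :
    state :=
  foldl (fun psi j => expmx ((0 -i* beta j) *: mixer) *m
                      (expmx ((0 -i* gamma j) *: costH c) *m psi))
        uniform_state (enum 'I_p).

Definition qaoa_expectation (p : nat) (c : bits -> R) (gamma beta : 'I_p -> R) :
    R[i] :=
  expectation (qaoa_state c gamma beta) (costH c).

End Qubits.

(* A word [:: g1; ...; gr] stands for g1 (g2 (... (gr C))), an iterated
   commutator of order r. *)
Inductive gradient : Type := Nabla | NablaC.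

Definition iterated_commutator (R : realType) (n : nat) (c : bits n -> R)
    (w : seq gradient) : operator R n :=
  foldr (fun g A => match g with Nabla => nabla A | NablaC => nablaC c A end)
        (costH c) w.

(* Formal finite linear combinations of gradient operator expectations. *)
Definition gradient_comb (R : realType) : Type := seq (R[i] * seq gradient).

Definition eval_comb (R : realType) (n : nat) (c : bits n -> R)
    (L : gradient_comb R) : R[i] :=
  \sum_(u <- L) u.1 * expect0 (iterated_commutator c u.2).

Definition angles (R : realType) (p : nat) (gamma beta : 'I_p -> R)
    (i : 'I_p + 'I_p) : R[i] :=
  match i with inl j => (gamma j)%:C | inr j => (beta j)%:C end.

(* Main.v *)
(* In the Heisenberg picture the cost expectation is
     < e^{i gamma_1 ad_C} e^{i beta_1 ad_B} ... e^{i gamma_p ad_C} e^{i beta_p ad_B} C >_0,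
   so the monomial with exponent m carries the coefficient i^|m| / m! times the
   expectation of one iterated commutator, of order |m|.  The truncated
   exponentials give the sums over the boxes of all m with entries < D; as these
   boxes are squeezed between simplices |m| < d, the sums over degrees have the
   same limit.
   In degree < 6 most words vanish: B|s> = n|s> kills those starting with [B, _],
   [C, C] = 0 those ending with [C, C], transposition those of odd length; by the
   Jacobi identity two of the remaining words agree. The coefficient of a word
   is computed by peeling off the first layer. *)
From HB Require Import structures.
Require Import Defs.
From mathcomp Require Import all_boot all_order all_algebra.
From mathcomp Require Import all_classical all_reals all_analysis.
From mathcomp Require Import ring.
Set Implicit Arguments.
Unset Strict Implicit.
Unset Printing Implicit Defensive.
Import Order.TTheory GRing.Theory Num.Theory numFieldNormedType.Exports.
Local Open Scope classical_set_scope.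
Local Open Scope sesquilinear_scope.
Local Open Scope ring_scope.
Local Open Scope complex_scope.

(** * Absolutely convergent series and sums over boxes *)

(** The obstacle is that two kinds of truncation meet: a product of exponentials truncates every
    exponent separately, whereas the theorem sums by total degree. The bridge [box_sum_sums_to] is
    crossed twice. With two variables, for the left and right factors of e^{xH} Y e^{-xH}, the
    degree sums are the iterated commutators of H with Y; with the 2p angles, they are the
    homogeneous parts of the QAOA expectation. Each crossing needs a bound on sums of absolute
    values: an iterated commutator grows at most geometrically with its order, so the factorials win
    and a product of scalar exponentials dominates. The remainder is indexed by words rather than by
    numbers, so that a single family of coefficients, independent of the cost function, serves all
    of them. *)

(* [R[i]] carries no complete-space instance in the library; this is the only
   consequence of completeness that is needed. *)
Definition abs_complete (K : numFieldType) : Prop :=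
  forall (u : nat -> K) (M : K),
    (forall D, \sum_(k < D) `|u k| <= M) -> cvgn (series u).

Section ComplexSequences.
Variable R : realType.
Local Notation C := (Num.NumField.sort R[i]).
Implicit Types (u v : nat -> C).

Lemma cvg_real_complex (u : nat -> R) (l : R) :
  u @ \oo --> l -> (fun k => (u k)%:C : C) @ \oo --> (l%:C : C).
Proof.
(* A positive element of R[i] is real, so the tolerance has zero imaginary part. *)
move=> ul; apply/cvgrPdist_lt => -[e1 e2]; rewrite ltcE /= => /andP[/eqP -> e0].
near=> k; rewrite -rmorphB normc_def /= expr0n addr0 sqrtr_sqr.
rewrite ltcR.
by near: k; move/cvgrPdist_lt : ul; apply.
Unshelve. all: by end_near. Qed.

Lemma cvg_complex_parts u :
  cvgn (fun k => complex.Re (u k)) -> cvgn (fun k => complex.Im (u k)) -> cvgn u.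
Proof.
set re := fun k => complex.Re (u k); set im := fun k => complex.Im (u k) => re_cvg im_cvg.
suff u_cvg : u @ \oo --> ((limn re)%:C : C) + ('i%C : C) * ((limn im)%:C : C).
  exact: cvgP u_cvg.
rewrite (_ : u = (fun k => (complex.Re (u k))%:C : C) \+
    (fun k => ('i%C : C) * ((complex.Im (u k))%:C : C))).
  apply: cvgD; first exact: cvg_real_complex.
  by apply: cvgM; [exact: cvg_cst|exact: cvg_real_complex].
by apply/funext => k /=; rewrite [LHS]complexE.
Qed.

Lemma abs_complete_complex : abs_complete R[i].
Proof.
move=> u M uM.
(* Real and imaginary parts are treated alike: both are additive and dominated by the modulus, so
   their series converge absolutely. *)
have ReM (f : R[i] -> R) : (forall x : R[i], `|f x|%:C <= `|x|) ->
    (forall (D : nat), f (\sum_(0 <= k < D) u k) = \sum_(0 <= k < D) f (u k)) ->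
    cvgn (fun k => f (series u k)).
  move=> f_le fD.
  rewrite (_ : (fun k => _) = series (fun k => f (u k))); last first.
    by apply/funext => D; rewrite /series /= fD.
  apply: normed_cvg; apply: nondecreasing_is_cvgn.
    by apply: nondecreasing_series => k _ _ /=.
  exists (complex.Re M) => _ [D _ <-].
  have : (\sum_(0 <= k < D) `|f (u k)|)%:C <= M.
    apply: le_trans (uM D); rewrite rmorph_sum big_mkord.
    by apply: ler_sum => k _; apply: f_le.
  by rewrite lecE => /andP[].
apply: cvg_complex_parts.
  apply: ReM => [x|D]; first exact: normc_ge_Re.
  exact: (raddf_sum (@complex.Re R : Rcomplex R -> R)).
apply: ReM => [x|D].
  have i_norm : `|'i%C : R[i]| = 1 by rewrite normc_def /= expr0n expr1n add0r sqrtr1.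
  (* The bound for Im x is the one for Re, applied to ix. *)
  by rewrite -normrN -ReiNIm (le_trans (normc_ge_Re _))// normrM i_norm mulr1.
exact: (raddf_sum (@complex.Im R : Rcomplex R -> R)).
Qed.

End ComplexSequences.

Lemma cvg_isometry (K : numFieldType) (f : {additive K -> K}) (u : nat -> K) (l : K) :
  (forall x, `|f x| = `|x|) ->
  u @ \oo --> l -> f \o u @ \oo --> f l.
Proof.
move=> f_norm /cvgrPdist_lt ul; apply/cvgrPdist_lt => e /ul; apply: filterS => k.
by rewrite /= -raddfB f_norm.
Qed.

(** The increments are nonnegative, so the sequence is a constant plus an absolutely summable
    series, to which [abs_complete] applies. *)
Lemma cvg_nondecreasing_bounded (K : numFieldType) (u : nat -> K) (M : K) :
  abs_complete K ->
  (forall k, u k <= u k.+1) -> (forall k, u k <= M) -> cvgn u.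
Proof.
move=> Kc u_nd uM.
have u_abs D : \sum_(k < D) `|telescope u k| <= M - u 0%N.
  rewrite (eq_bigr (fun k : 'I_D => telescope u k)) => [|k _]; last first.
    by rewrite ger0_norm // subr_ge0.
  rewrite -(big_mkord predT (telescope u)) -[X in X <= _]/(series (telescope u) D).
  by rewrite telescopeK /= lerB.
rewrite (_ : u = cst (u 0%N) \+ series (telescope u)); last first.
  by apply/funext => k /=; rewrite -eq_sum_telescope.
by apply: is_cvgD; [exact: is_cvg_cst|exact: Kc u_abs].
Qed.

Section BoxSums.
Variables (K : numFieldType) (I : finType).
Implicit Types (a : (I -> nat) -> K) (t : I -> K).

Definition box_sum a t (D : nat) : K :=
  \sum_(m : {ffun I -> 'I_D}) a (fun i => m i) * \prod_i t i ^+ m i.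

(** The two sums range over different finite types. [widen_ord] embeds the small box, and [inord]
    inverts it on the multi-indices that satisfy [P]. *)
Lemma sum_box_widen (V : nmodType) (f : (I -> nat) -> V) (P : pred (I -> nat))
    (d D : nat) : (d <= D)%N -> (forall m, P m -> forall i, (m i < d)%N) ->
  \sum_(m : {ffun I -> 'I_d} | P (fun i => m i)) f (fun i => m i) =
  \sum_(m : {ffun I -> 'I_D} | P (fun i => m i)) f (fun i => m i).
Proof.
move=> dD Pd.
(* [inord] needs a nonempty target. For d = 0 both sums are empty if I is inhabited; if I is empty,
   both have exactly one term. *)
case: d dD Pd => [|d] dD Pd.
  case: (pickP (mem I)) => [i _|I0].
    rewrite !big_pred0 // => m; apply/negP => /Pd/(_ i) //.
  have mE m m' : m = m' :> (I -> nat) by apply/funext => i; have := I0 i.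
  have card0 (J : finType) : #|{ffun I -> J}| = 1%N.
    by rewrite card_ffun (eq_card0 I0).
  have /fintype1[m0 m0E] := card0 'I_0.
  have /fintype1[m1 m1E] := card0 'I_D.
  rewrite big_mkcond [RHS]big_mkcond /= (big_pred1 m0) => [|m]; last by rewrite (m0E m) /= eqxx.
  rewrite (big_pred1 m1) => [|m]; last by rewrite (m1E m) /= eqxx.
  by rewrite (mE (fun i => m0 i) (fun i => m1 i)).
rewrite [RHS](reindex_onto (fun m : {ffun I -> 'I_d.+1} => [ffun i => widen_ord dD (m i)])
  (fun m : {ffun I -> 'I_D} => [ffun i => inord (m i)])) /=; last first.
  move=> m /Pd md; apply/ffunP => i; rewrite !ffunE; apply: val_inj => /=.
  by rewrite inordK.
have E (m : {ffun I -> 'I_d.+1}) :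
    (fun i => [ffun i => widen_ord dD (m i)] i) = (fun i => m i) :> (I -> nat).
  by apply/funext => i; rewrite ffunE.
apply: eq_big => [m|m _]; last by rewrite E.
rewrite E (_ : _ == m); first by rewrite andbT.
apply/eqP/ffunP => i; rewrite !ffunE; apply: val_inj => /=.
by rewrite inordK.
Qed.

Lemma leq_mdegree (m : I -> nat) i : (m i <= mdegree m)%N.
Proof. by rewrite /mdegree (bigD1 i) //= leq_addr. Qed.

Lemma series_homogeneous_part a t (D : nat) :
  series (homogeneous_part a t) D =
  \sum_(m : {ffun I -> 'I_D} | (mdegree (fun i => m i) < D)%N)
     a (fun i => m i) * \prod_i t i ^+ m i.
Proof.
pose f (m : I -> nat) := a m * \prod_i t i ^+ m i.
rewrite /series /= big_mkord.
transitivity (\sum_(d < D) \sum_(m : {ffun I -> 'I_D} | mdegree (fun i => m i) == d)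
   f (fun i => m i)).
  apply: eq_bigr => d _; rewrite /homogeneous_part.
  apply: (@sum_box_widen _ f (fun m => mdegree m == d)) => // m /eqP <- i.
  by rewrite ltnS leq_mdegree.
rewrite (exchange_big_dep (fun m : {ffun I -> 'I_D} => mdegree (fun i => m i) < D)%N) /=.
  by apply: eq_bigr => m mD; rewrite (big_pred1 (Ordinal mD)).
by move=> d m _ /eqP ->.
Qed.

Lemma series_homogeneous_part_box a t (D N : nat) : (D <= N)%N ->
  series (homogeneous_part a t) D =
  \sum_(m : {ffun I -> 'I_N} | (mdegree (fun i => m i) < D)%N)
     a (fun i => m i) * \prod_i t i ^+ m i.
Proof.
move=> DN; rewrite series_homogeneous_part.
apply: (@sum_box_widen _ (fun m => a m * \prod_i t i ^+ m i)
  (fun m => mdegree m < D)%N) => // m mD i.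
exact: leq_ltn_trans (leq_mdegree _ _) mD.
Qed.

Let abs_term a t (m : I -> nat) : K := `|a m| * \prod_i `|t i| ^+ m i.

Let abs_term_ge0 a t m : 0 <= abs_term a t m.
Proof. by rewrite mulr_ge0 // prodr_ge0 // => i _; rewrite exprn_ge0. Qed.

(** With A the degree sums and B the box sums of absolute values, A D <= B D <= A (N D). Hence A is
    monotone and bounded, and the terms by which a box sum exceeds a degree sum have total size at
    most A (N D) - A D, which tends to 0. *)
Lemma box_sum_sums_to a t (s M : K) : abs_complete K ->
  (forall D, box_sum (fun m => `|a m|) (fun i => `|t i|) D <= M) ->
  box_sum a t @ \oo --> s -> mpseries_sums_to a t s.
Proof.
move=> Kc aM a_s.
set A := series (homogeneous_part (fun m => `|a m|) (fun i => `|t i|)).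
set B := box_sum (fun m => `|a m|) (fun i => `|t i|) in aM.
have AB D : A D <= B D.
  rewrite /A series_homogeneous_part /B /box_sum big_mkcond /=.
  apply: ler_sum => m _; case: ifP => // _; exact: abs_term_ge0.
have A_nd D : A D <= A D.+1.
  rewrite /A /series /= big_nat_recr //= lerDl.
  apply: sumr_ge0 => m _; exact: abs_term_ge0.
(* Exponents below D have total degree at most #|I| * D, hence below N D. The extra factor D keeps D
   <= N D, and so N unbounded, even when I is empty. *)
pose N D := (#|I|.+1 * D).+1.
have BA D : B D <= A (N D).
  rewrite /A (@series_homogeneous_part_box _ _ _ (N D)) //.
  pose in_box (m : I -> nat) := [forall i, (m i < D)%N].
  rewrite /B /box_sum (eq_bigl (fun m : {ffun I -> 'I_D} => in_box (fun i => m i))); last first.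
    by move=> m; apply/esym/forallP => i.
  have DN : (D <= N D)%N.
    by rewrite /N -addn1 (leq_trans (leq_pmull D (ltn0Sn #|I|))) // leq_addr.
  rewrite (@sum_box_widen _ (abs_term a t) in_box _ _ DN); last by move=> m /forallP.
  rewrite big_mkcond [leRHS]big_mkcond /=; apply: ler_sum => m _.
  case: ifP => [/forallP mD|_]; last by case: ifP => // _; exact: abs_term_ge0.
  suff -> : (mdegree (fun i => m i) < N D)%N by [].
  rewrite ltnS mulSn (leq_trans _ (leq_addl _ _)) // /mdegree.
  by rewrite -sum_nat_const; apply: leq_sum => i _; rewrite ltnW.
have A_cvg : cvgn A.
  apply: (cvg_nondecreasing_bounded Kc A_nd) => D.
  exact: le_trans (AB D) (aM D).
split=> //.
have A0 : (fun D => A (N D) - A D) @ \oo --> 0.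
  rewrite -(subrr (limn A)); apply: cvgB => //.
  apply: (cvg_comp _ _ _ A_cvg).
  apply/cvgnyPge => n; near=> D; rewrite /N.
  rewrite (leq_trans (_ : n <= D)%N) //; first by near: D; exact: nbhs_infty_ge.
  by rewrite -addn1 (leq_trans (leq_pmull D (ltn0Sn #|I|))) // leq_addr.
rewrite -[s]subr0.
rewrite (_ : series _ = box_sum a t \-
    (fun D => box_sum a t D - series (homogeneous_part a t) D)); last first.
  by apply/funext => D /=; rewrite subKr.
apply: cvgB => //; apply/cvgrPdist_lt => e e0.
near=> D; rewrite sub0r normrN.
have : `|0 - (A (N D) - A D)| < e.
  by near: D; move/cvgrPdist_lt : A0; apply.
rewrite sub0r normrN; apply: le_lt_trans.
rewrite [leRHS]ger0_norm ?subr_ge0 ?(le_trans (AB D)) //.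
apply: (@le_trans _ _ (B D - A D)); last by rewrite lerB.
(* Cancelling the common part of degree below D leaves, on both sides, the box terms of degree at
   least D; these are compared one by one. *)
rewrite series_homogeneous_part /A series_homogeneous_part /B /box_sum.
rewrite (bigID (fun m : {ffun I -> 'I_D} => mdegree (fun i => m i) < D)%N) /= addrAC subrr add0r.
rewrite [X in _ <= X - _](bigID (fun m : {ffun I -> 'I_D} => mdegree (fun i => m i) < D)%N) /=.
rewrite [leRHS]addrAC subrr add0r.
apply: le_trans (ler_norm_sum _ _ _) _; apply: ler_sum => m _.
by rewrite normrM normr_prod (eq_bigr _ (fun i _ => normrX (m i) (t i))).
Unshelve. all: by end_near. Qed.
End BoxSums.

(** Together with [abs_complete] this is what the matrix sections assume of the scalars; both are
    purely order-theoretic, so they make sense over any [numFieldType]. *)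
Definition exp_bounded (K : numFieldType) : Prop :=
  forall x : K, 0 <= x -> exists E : K, forall D,
    \sum_(k < D) x ^+ k / k`!%:R <= E.

Lemma exp_bounded_complex (R : realType) : exp_bounded R[i].
Proof.
move=> x x0; have xE : x = (complex.Re x)%:C by rewrite RRe_real // ger0_real.
have r0 : 0 <= complex.Re x by move: x0; rewrite xE ler0c.
exists (expR (complex.Re x))%:C => D; rewrite [in leLHS]xE.
rewrite (_ : \sum_(_ < _) _ = (\sum_(k < D) complex.Re x ^+ k / k`!%:R)%:C); last first.
  by rewrite rmorph_sum; apply: eq_bigr => k _; rewrite rmorphM rmorphXn fmorphV rmorph_nat.
rewrite lecR -(big_mkord predT (fun k => complex.Re x ^+ k / k`!%:R)).
apply: (nondecreasing_cvgn_le _ (is_cvg_series_exp_coeff (complex.Re x))).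
by apply: nondecreasing_series => k _ _; apply: exp_coeff_ge0.
Qed.

(** * The matrix exponential and iterated commutators *)

Section EntrywiseNorm.
Variable K : numDomainType.

(** This norm is submultiplicative and dominates every entry, which suits entrywise limits. *)
Definition entry_norm m n (A : 'M[K]_(m, n)) : K := \sum_i \sum_j `|A i j|.

Lemma entry_norm_ge0 m n (A : 'M[K]_(m, n)) : 0 <= entry_norm A.
Proof. by apply: sumr_ge0 => i _; apply: sumr_ge0. Qed.

Lemma le_entry_norm m n (A : 'M[K]_(m, n)) i j : `|A i j| <= entry_norm A.
Proof.
rewrite /entry_norm (bigD1 i) //= (bigD1 j) //= -addrA lerDl addr_ge0 //.
  by apply: sumr_ge0.
by apply: sumr_ge0 => k _; apply: sumr_ge0.
Qed.

Lemma entry_normD m n (A B : 'M[K]_(m, n)) :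
  entry_norm (A + B) <= entry_norm A + entry_norm B.
Proof.
rewrite /entry_norm -big_split; apply: ler_sum => i _ /=.
by rewrite -big_split; apply: ler_sum => j _; rewrite mxE ler_normD.
Qed.

Lemma entry_normN m n (A : 'M[K]_(m, n)) : entry_norm (- A) = entry_norm A.
Proof. by apply: eq_bigr => i _; apply: eq_bigr => j _; rewrite mxE normrN. Qed.

Lemma entry_norm_mul m n p (A : 'M[K]_(m, n)) (B : 'M[K]_(n, p)) :
  entry_norm (A *m B) <= entry_norm A * entry_norm B.
Proof.
rewrite /entry_norm mulr_suml; apply: ler_sum => i _.
apply: (@le_trans _ _ (\sum_j \sum_k `|A i k| * `|B k j|)).
  apply: ler_sum => j _; rewrite mxE; apply: le_trans (ler_norm_sum _ _ _) _.
  by apply: ler_sum => k _; rewrite normrM.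
rewrite exchange_big mulr_suml; apply: ler_sum => k _ /=.
rewrite -mulr_sumr ler_wpM2l // (bigD1 k) //= lerDl.
by apply: sumr_ge0 => l _; apply: sumr_ge0.
Qed.

(** The identity does not have norm 1 in general, hence the constant factor; it is independent of
    k. *)
Lemma entry_norm_exp n (A : 'M[K]_n) k :
  entry_norm (A ^+ k) <= entry_norm A ^+ k * entry_norm (1%:M : 'M[K]_n).
Proof.
elim: k => [|k IHk]; first by rewrite !expr0 mul1r.
rewrite !exprS -mulrA; apply: le_trans (entry_norm_mul _ _) _.
by rewrite ler_wpM2l // entry_norm_ge0.
Qed.

End EntrywiseNorm.

Section MatrixConvergence.
Variable K : numFieldType.

Definition cvg_mx m n (u : nat -> 'M[K]_(m, n)) (A : 'M[K]_(m, n)) : Prop :=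
  forall i j, (fun k => u k i j) @ \oo --> A i j.

Lemma cvg_mx_cst m n (A : 'M[K]_(m, n)) : cvg_mx (fun=> A) A.
Proof. by move=> i j; apply: cvg_cst. Qed.

Lemma cvg_bigsum (I : finType) (P : pred I) (u : nat -> I -> K) (a : I -> K) :
  (forall i, (fun k => u k i) @ \oo --> a i) ->
  (fun k => \sum_(i | P i) u k i) @ \oo --> \sum_(i | P i) a i.
Proof.
move=> ua; elim: (index_enum I) => [|i r IHr].
  rewrite big_nil; under eq_fun do rewrite big_nil; exact: cvg_cst.
rewrite big_cons; under eq_fun do rewrite big_cons.
by case: (P i) => //; apply: cvgD.
Qed.

Lemma cvg_mx_mul m n p (u : nat -> 'M[K]_(m, n)) A (v : nat -> 'M[K]_(n, p)) B :
  cvg_mx u A -> cvg_mx v B -> cvg_mx (fun k => u k *m v k) (A *m B).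
Proof.
move=> uA vB i j; rewrite mxE; under eq_fun do rewrite mxE.
by apply: cvg_bigsum => k; apply: cvgM.
Qed.

End MatrixConvergence.

Lemma sum_box_bool (V : nmodType) (D : nat) (g : nat -> nat -> V) :
  \sum_(m : {ffun bool -> 'I_D}) g (m true) (m false) =
  \sum_(k < D) \sum_(l < D) g k l.
Proof.
rewrite pair_big /= (reindex (fun kl : 'I_D * 'I_D =>
  [ffun b : bool => if b then kl.1 else kl.2])) /=.
  by apply: eq_bigr => kl _; rewrite !ffunE.
exists (fun m : {ffun bool -> 'I_D} => (m true, m false)) => [[k l] _|m _].
  by rewrite !ffunE.
by apply/ffunP => -[]; rewrite ffunE.
Qed.

Lemma sum_simplex_bool (V : nmodType) (d : nat) (g : nat -> nat -> V) :
  \sum_(m : {ffun bool -> 'I_d.+1} | mdegree (fun b => m b) == d)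
    g (m true) (m false) = \sum_(k < d.+1) g k (d - k)%N.
Proof.
rewrite (eq_bigl (fun m : {ffun bool -> 'I_d.+1} => m true + m false == d)%N) => [|m]; last first.
  by rewrite /mdegree big_bool.
rewrite big_mkcond /= (@sum_box_bool V d.+1 (fun k l => if (k + l == d)%N then g k l else 0)).
apply: eq_bigr => k _; rewrite -big_mkcond /= (big_pred1 (inord (d - k))) => [|l].
  by rewrite inordK // ltnS leq_subr.
rewrite /= -val_eqE /= inordK ?ltnS ?leq_subr //.
have kd : (k <= d)%N by rewrite -ltnS.
by rewrite -[in RHS](eqn_add2l k) subnKC.
Qed.

Section MatrixExponential.
Variables (K : numFieldType) (N : nat).
Hypotheses (Kc : abs_complete K) (Ke : exp_bounded K).
Implicit Types (A H Y : 'M[K]_N) (x : K).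

Definition bracket H Y : 'M[K]_N := H *m Y - Y *m H.

Lemma exprZmx x A k : (x *: A) ^+ k = x ^+ k *: A ^+ k.
Proof.
elim: k => [|k IHk]; first by rewrite !expr0 scale1r.
by rewrite !exprS IHk -!mulmxE -scalemxAl -scalemxAr scalerA.
Qed.

Lemma cvg_expmx A : cvg_mx (fun D => \sum_(k < D) (k`!%:R)^-1 *: A ^+ k) (expmx A).
Proof.
move=> i j; rewrite mxE.
rewrite (_ : (fun D => _) = series (fun k => (A ^+ k) i j / k`!%:R)); last first.
  apply/funext => D; rewrite /series /= summxE big_mkord.
  by apply: eq_bigr => k _; rewrite mxE mulrC.
have [E ED] := Ke (entry_norm_ge0 A).
apply: (@Kc _ (entry_norm (1%:M : 'M[K]_N) * E)) => D.
apply: le_trans (ler_wpM2l (entry_norm_ge0 _) (ED D)); rewrite mulr_sumr.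
apply: ler_sum => k _; rewrite normrM normfV normr_nat mulrA.
rewrite ler_wpM2r ?invr_ge0 // mulrC.
exact: le_trans (le_entry_norm _ _ _) (entry_norm_exp _ _).
Qed.

Lemma cvg_expmxZ x H :
  cvg_mx (fun D => \sum_(k < D) (x ^+ k / k`!%:R) *: H ^+ k) (expmx (x *: H)).
Proof.
rewrite (_ : (fun D => _) = fun D => \sum_(k < D) (k`!%:R)^-1 *: (x *: H) ^+ k).
  exact: cvg_expmx.
apply/funext => D; apply: eq_bigr => k _.
by rewrite exprZmx scalerA mulrC.
Qed.

(** The bracket is left multiplication by H minus right multiplication by H. These two commute, so
    its powers expand binomially. *)
Lemma iter_bracket H Y d :
  iter d (bracket H) Y =
  \sum_(k < d.+1) ((-1) ^+ (d - k) * 'C(d, k)%:R) *: (H ^+ k *m Y *m H ^+ (d - k)).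
Proof.
elim: d => [|d IHd].
  by rewrite big_ord1 !expr0 mul1r scale1r mul1mx mulmx1.
have bump0 k : bump 0 k = k.+1 by [].
rewrite iterS {}IHd /bracket mulmx_sumr mulmx_suml [RHS]big_ord_recl /= bin0 subn0.
(* Pascal's rule: one half is left multiplication by H of the expansion for d; the other, with the
   term k = 0 split off, is its right multiplication. *)
have -> : \sum_(i < d.+1) ((-1) ^+ (d.+1 - bump 0 i) * 'C(d.+1, bump 0 i)%:R) *:
      (H ^+ bump 0 i *m Y *m H ^+ (d.+1 - bump 0 i)) =
    \sum_(k < d.+1) H *m (((-1) ^+ (d - k) * 'C(d, k)%:R) *: (H ^+ k *m Y *m H ^+ (d - k))) +
    \sum_(k < d.+1) ((-1) ^+ (d - k) * 'C(d, k.+1)%:R) *: (H ^+ k.+1 *m Y *m H ^+ (d - k)).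
  rewrite -big_split; apply: eq_bigr => k _ /=.
  rewrite bump0 subSS binS natrD mulrDr scalerDl addrC; congr (_ + _).
  by rewrite -scalemxAr !mulmxA exprS mulmxE.
rewrite addrCA; congr (_ + _).
rewrite [X in - X]big_ord_recl [X in _ = _ + X]big_ord_recr /=.
rewrite (@bin_small d d.+1) // mulr0n mulr0 scale0r addr0 opprD; congr (_ + _).
  by rewrite subn0 bin0 -scalemxAl !mulr1 -scaleNr exprS mulN1r -mulmxA [H ^+ d.+1]exprSr mulmxE.
rewrite -sumrN; apply: eq_bigr => k _; rewrite bump0.
have dk : (d - k = (d - k.+1).+1)%N by rewrite subnSK.
rewrite -scalemxAl -scaleNr dk -mulNr -mulN1r -exprS -dk.
by rewrite -mulmxA; congr (_ *: (_ *m _)); rewrite [in RHS]dk exprSr.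
Qed.

(** Each entry is a power series in two variables, evaluated at x for the powers left of Y and at -x
    for those on the right. Its box sums are products of truncated exponentials; its homogeneous
    parts are the brackets, by [iter_bracket]. *)
Lemma cvg_iter_bracket x H Y :
  cvg_mx (fun D => \sum_(k < D) (x ^+ k / k`!%:R) *: iter k (bracket H) Y)
    (expmx (x *: H) *m Y *m expmx (- x *: H)).
Proof.
move=> i j.
pose a (m : bool -> nat) : K :=
  (H ^+ m true *m Y *m H ^+ m false) i j / (m true)`!%:R / (m false)`!%:R.
pose t (b : bool) := if b then x else - x.
have tE d (m : {ffun bool -> 'I_d}) : \prod_b t b ^+ m b = x ^+ m true * (- x) ^+ m false.
  by rewrite big_bool.
pose g k l := (H ^+ k *m Y *m H ^+ l) i j / k`!%:R / l`!%:R * (x ^+ k * (- x) ^+ l).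
have box : box_sum a t @ \oo --> (expmx (x *: H) *m Y *m expmx (- x *: H)) i j.
  rewrite (_ : box_sum a t = fun D => ((\sum_(k < D) (x ^+ k / k`!%:R) *: H ^+ k) *m Y *m
      (\sum_(k < D) ((- x) ^+ k / k`!%:R) *: H ^+ k)) i j).
    exact: (cvg_mx_mul (cvg_mx_mul (@cvg_expmxZ x H) (@cvg_mx_cst K N N Y)) (@cvg_expmxZ (- x) H)).
  apply/funext => D.
  rewrite /box_sum (eq_bigr (fun m : {ffun bool -> 'I_D} => g (m true) (m false))); last first.
    by move=> m _; rewrite tE.
  rewrite sum_box_bool !mulmx_suml summxE; apply: eq_bigr => k _.
  rewrite mulmx_sumr summxE; apply: eq_bigr => l _.
  by rewrite -scalemxAr -!scalemxAl scalerA mxE /g; ring.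
have [E ED] := Ke (mulr_ge0 (normr_ge0 x) (entry_norm_ge0 H)).
(* Each of the two powers of H costs one factor [entry_norm 1%:M]. *)
pose c := (entry_norm (1%:M : 'M[K]_N)) ^+ 2 * entry_norm Y.
have [|_] := @box_sum_sums_to _ _ a t _ (c * E * E) Kc _ box.
  move=> D; pose h k := (`|x| * entry_norm H) ^+ k / k`!%:R.
  have c0 : 0 <= c by rewrite mulr_ge0 ?exprn_ge0 // entry_norm_ge0.
  have h0 k : 0 <= h k by rewrite divr_ge0 ?exprn_ge0 ?mulr_ge0 // entry_norm_ge0.
  apply: (@le_trans _ _ (c * (\sum_(k < D) h k) * (\sum_(l < D) h l))); last first.
    by rewrite -!(mulrA c) ler_wpM2l // ler_pM // ?sumr_ge0.
  rewrite -(mulrA c) mulr_suml mulr_sumr; under [leRHS]eq_bigr do rewrite 2!mulr_sumr.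
  rewrite -(@sum_box_bool _ D (fun k l => c * (h k * h l))).
  apply: ler_sum => m _; rewrite big_bool /a /t /= normrN.
  rewrite !normrM !normfV !normr_nat.
  apply: (@le_trans _ _ ((entry_norm H ^+ m true * entry_norm (1%:M : 'M[K]_N) * entry_norm Y *
     (entry_norm H ^+ m false * entry_norm (1%:M : 'M[K]_N))) / (m true)`!%:R / (m false)`!%:R
     * (`|x| ^+ m true * `|x| ^+ m false))).
    rewrite ler_wpM2r ?mulr_ge0 ?exprn_ge0 // ler_wpM2r ?invr_ge0 // ler_wpM2r ?invr_ge0 //.
    apply: le_trans (le_entry_norm _ _ _) _; apply: le_trans (entry_norm_mul _ _) _.
    apply: ler_pM; rewrite ?entry_norm_ge0 // ?entry_norm_exp //.
    by apply: le_trans (entry_norm_mul _ _) _; rewrite ler_wpM2r ?entry_norm_ge0 // entry_norm_exp.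
  by rewrite le_eqVlt; apply/orP; left; apply/eqP; rewrite /c /h !exprMn; ring.
rewrite (_ : series _ = fun D => (\sum_(k < D) (x ^+ k / k`!%:R) *:
    iter k (bracket H) Y) i j) //.
apply/funext => D; rewrite /series /= summxE big_mkord; apply: eq_bigr => d _.
rewrite /homogeneous_part.
rewrite (eq_bigr (fun m : {ffun bool -> 'I_d.+1} => g (m true) (m false))); last first.
  by move=> m _; rewrite tE.
rewrite sum_simplex_bool iter_bracket mxE summxE mulr_sumr.
apply: eq_bigr => k _; rewrite mxE /g.
have kd : (k <= d)%N by rewrite -ltnS.
have fact_neq0 n : n`!%:R != 0 :> K by rewrite pnatr_eq0 -lt0n fact_gt0.
have -> : x ^+ d = x ^+ k * x ^+ (d - k) by rewrite -exprD subnKC.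
have -> : (- x) ^+ (d - k) = (-1) ^+ (d - k) * x ^+ (d - k) by rewrite -exprMn mulN1r.
(* This identifies the coefficient 1/(k! (d-k)!) of the double series with C(d,k)/d!. *)
have <- : 'C(d, k)%:R * (k`!%:R * (d - k)`!%:R) = d`!%:R :> K.
  by rewrite -!natrM mulnA -mulnA bin_fact.
have bin_neq0 : 'C(d, k)%:R != 0 :> K by rewrite pnatr_eq0 -lt0n bin_gt0.
by field; rewrite bin_neq0 !fact_neq0.
Qed.

End MatrixExponential.

Section TruncatedExponential.
Variables (K : numFieldType) (N : nat).
Hypotheses (Kc : abs_complete K) (Ke : exp_bounded K).
Implicit Types (H Y : 'M[K]_N) (x : K).

Lemma iter_bracket_sum H k (I : finType) (a : I -> K) (Y : I -> 'M[K]_N) :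
  iter k (bracket H) (\sum_i a i *: Y i) = \sum_i a i *: iter k (bracket H) (Y i).
Proof.
elim: k => [//|k IHk]; rewrite iterS IHk /bracket mulmx_sumr mulmx_suml -sumrB.
by apply: eq_bigr => i _; rewrite -scalemxAl -scalemxAr -scalerBr.
Qed.

Definition exp_bracket (D : nat) x H Y : 'M[K]_N :=
  \sum_(k < D) (x ^+ k / k`!%:R) *: iter k (bracket H) Y.

Lemma exp_bracket_sum D x H (I : finType) (a : I -> K) (Y : I -> 'M[K]_N) :
  exp_bracket D x H (\sum_i a i *: Y i) = \sum_i a i *: exp_bracket D x H (Y i).
Proof.
rewrite /exp_bracket; under eq_bigr do rewrite iter_bracket_sum scaler_sumr.
rewrite exchange_big; apply: eq_bigr => i _ /=.
by rewrite scaler_sumr; apply: eq_bigr => k _; rewrite !scalerA mulrC.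
Qed.

Definition heisenberg x H Y : 'M[K]_N := expmx (x *: H) *m Y *m expmx (- x *: H).

Lemma heisenberg_sum x H (I : finType) (a : I -> K) (Y : I -> 'M[K]_N) :
  heisenberg x H (\sum_i a i *: Y i) = \sum_i a i *: heisenberg x H (Y i).
Proof.
rewrite /heisenberg mulmx_sumr mulmx_suml.
by apply: eq_bigr => i _; rewrite -scalemxAr -scalemxAl.
Qed.

Lemma matrix_sum_delta_pair Y :
  Y = \sum_(ij : 'I_N * 'I_N) Y ij.1 ij.2 *: delta_mx ij.1 ij.2.
Proof. by rewrite [LHS]matrix_sum_delta pair_big. Qed.

(** The truncation order and the argument vary together. Expanding the argument on matrix units
    separates them: the finitely many coordinates converge, and on each fixed matrix unit
    [cvg_iter_bracket] applies, so no uniform estimate arises. *)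
Lemma cvg_exp_bracket x H (u : nat -> 'M[K]_N) Y : cvg_mx u Y ->
  cvg_mx (fun D => exp_bracket D x H (u D)) (heisenberg x H Y).
Proof.
move=> uY i j; rewrite [Y]matrix_sum_delta_pair heisenberg_sum summxE.
under eq_fun do rewrite [X in exp_bracket _ _ _ X]matrix_sum_delta_pair exp_bracket_sum summxE.
apply: cvg_bigsum => kl; rewrite mxE; under eq_fun do rewrite mxE.
apply: cvgM; first exact: uY.
exact: (@cvg_iter_bracket K N Kc Ke x H (delta_mx kl.1 kl.2) i j).
Qed.

End TruncatedExponential.

(** * Expanding the layers into words of gradients *)

Section WordSums.

Lemma sum_ffun_recl (V : nmodType) p (J : finType) (G : ('I_p.+1 -> J) -> V) :
  \sum_(f : {ffun 'I_p.+1 -> J}) G f =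
  \sum_x \sum_(f : {ffun 'I_p -> J}) G (fun i => oapp f x (unlift ord0 i)).
Proof.
rewrite pair_big /= (reindex (fun xf : J * {ffun 'I_p -> J} =>
  [ffun i => oapp xf.2 xf.1 (unlift ord0 i)])) /=.
  by apply: eq_bigr => xf _; congr G; apply/funext => i; rewrite ffunE.
exists (fun f : {ffun 'I_p.+1 -> J} => (f ord0, [ffun i => f (lift ord0 i)])) => [[x f] _|f _].
  rewrite /= ffunE unlift_none /=; congr (_, _).
  by apply/ffunP => i; rewrite !ffunE liftK.
apply/ffunP => i; rewrite ffunE /=.
by case: unliftP => [j ->|->] /=; rewrite ?ffunE.
Qed.

Definition layer_word p (k l : 'I_p -> nat) : seq gradient :=
  flatten [seq nseq (k j) NablaC ++ nseq (l j) Nabla | j <- enum 'I_p].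

Lemma layer_word_recl p (k l : 'I_p.+1 -> nat) :
  layer_word k l = nseq (k ord0) NablaC ++ nseq (l ord0) Nabla ++
    layer_word (fun j => k (lift ord0 j)) (fun j => l (lift ord0 j)).
Proof. by rewrite /layer_word enum_ordSl /= -map_comp catA. Qed.

Variables (F : fieldType) (V : lmodType F).

(** The truncated product of exponentials in noncommuting letters, with [G] evaluated on each
    resulting word. Since [G] is arbitrary, the same recursion over layers serves for operators, for
    expectations and for the indicator of a single word. *)
Definition word_sum p D (gamma beta : 'I_p -> F) (G : seq gradient -> V) : V :=
  \sum_(f : {ffun 'I_p -> 'I_D * 'I_D})
    (\prod_j (gamma j ^+ (f j).1 / ((f j).1)`!%:R * (beta j ^+ (f j).2 / ((f j).2)`!%:R))) *:
    G (layer_word (fun j => (f j).1) (fun j => (f j).2)).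

Lemma word_sum0 D (gamma beta : 'I_0 -> F) G : word_sum D gamma beta G = G [::].
Proof.
have /fintype1[f0 f0E] : #|{ffun 'I_0 -> 'I_D * 'I_D}| = 1%N by rewrite card_ffun card_ord.
rewrite /word_sum (big_pred1 f0) => [|f]; last by rewrite (f0E f) /= eqxx.
by rewrite big_ord0 scale1r /layer_word enum_ord0.
Qed.

Lemma word_sumS p D (gamma beta : 'I_p.+1 -> F) G :
  word_sum D gamma beta G =
  \sum_(k < D) \sum_(l < D)
    (gamma ord0 ^+ k / k`!%:R * (beta ord0 ^+ l / l`!%:R)) *:
    word_sum D (fun j => gamma (lift ord0 j)) (fun j => beta (lift ord0 j))
      (fun w => G (nseq k NablaC ++ nseq l Nabla ++ w)).
Proof.
rewrite /word_sum (@sum_ffun_recl _ _ _ (fun f : 'I_p.+1 -> 'I_D * 'I_D =>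
    (\prod_j (gamma j ^+ (f j).1 / ((f j).1)`!%:R * (beta j ^+ (f j).2 / ((f j).2)`!%:R))) *:
    G (layer_word (fun j => (f j).1) (fun j => (f j).2)))) [RHS]pair_big /=.
apply: eq_bigr => kl _; rewrite scaler_sumr; apply: eq_bigr => f _.
rewrite big_ord_recl layer_word_recl unlift_none /= scalerA.
congr (_ *: _); first by congr (_ * _); apply: eq_bigr => j _; rewrite liftK.
congr (G (_ ++ (_ ++ _))); by congr layer_word; apply/funext => j; rewrite liftK.
Qed.

End WordSums.

(** * The QAOA expectation as a power series *)

Section Qaoa.
Variables (R : realType) (n : nat).
Local Notation C := R[i].
Implicit Types (c : bits n -> R) (A : operator R n).

Lemma iterated_commutator_cat c k l w :
  iterated_commutator c (nseq k NablaC ++ nseq l Nabla ++ w) =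
  iter k (bracket (costH c)) (iter l (bracket (mixer R n)) (iterated_commutator c w)).
Proof.
rewrite /iterated_commutator !foldr_cat; set X := foldr _ _ w.
by elim: k => [|k /= ->//] /=; elim: l => [|l /= ->].
Qed.

Lemma word_sum_iterated_commutator p D (gamma beta : 'I_p.+1 -> C) c :
  word_sum D gamma beta (iterated_commutator c) =
  exp_bracket D (gamma ord0) (costH c) (exp_bracket D (beta ord0) (mixer R n)
    (word_sum D (fun j => gamma (lift ord0 j)) (fun j => beta (lift ord0 j))
       (iterated_commutator c))).
Proof.
rewrite word_sumS /exp_bracket; apply: eq_bigr => k _.
rewrite iter_bracket_sum scaler_sumr; apply: eq_bigr => l _.
rewrite scalerA; congr (_ *: _).
rewrite /word_sum !iter_bracket_sum; apply: eq_bigr => f _.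
by rewrite iterated_commutator_cat.
Qed.

Lemma cvg_word_sum p (gamma beta : 'I_p -> C) c :
  cvg_mx (fun D => word_sum D gamma beta (iterated_commutator c))
    (foldr (fun j A => heisenberg (gamma j) (costH c) (heisenberg (beta j) (mixer R n) A))
       (costH c) (enum 'I_p)).
Proof.
elim: p gamma beta => [|p IHp] gamma beta.
  rewrite enum_ord0 /=; under eq_fun do rewrite word_sum0.
  exact: cvg_mx_cst.
rewrite enum_ordSl /= foldr_map /=.
under eq_fun do rewrite word_sum_iterated_commutator.
apply: (cvg_exp_bracket (@abs_complete_complex R) (@exp_bounded_complex R)).
exact: (cvg_exp_bracket (@abs_complete_complex R) (@exp_bounded_complex R)).
Qed.

End Qaoa.

Section TruncatedPowerSeries.
Variables (K : numFieldType) (I : finType).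
Implicit Types (a : (I -> nat) -> K) (t : I -> K).

Lemma homogeneous_part_drop a t (d : nat) :
  homogeneous_part (fun m => if (mdegree m < d)%N then 0 else a m) t =
  fun e => if (e < d)%N then 0 else homogeneous_part a t e.
Proof.
apply/funext => e; rewrite /homogeneous_part; case: ifP => ed.
  by rewrite big1 // => m /eqP ->; rewrite ed mul0r.
by apply: eq_bigr => m /eqP ->; rewrite ed.
Qed.

Lemma cvg_series_drop (u : nat -> K) (d : nat) (l : K) :
  series u @ \oo --> l ->
  series (fun e => if (e < d)%N then 0 else u e) @ \oo --> l - series u d.
Proof.
move=> ul.
have : series u \- cst (series u d) @ \oo --> l - series u d.
  by apply: cvgB => //; apply: cvg_cst.
apply: cvg_trans; apply: near_eq_cvg; near=> D => /=.
have dD : (d <= D)%N by near: D; exact: nbhs_infty_ge.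
rewrite /series /= (big_cat_nat (leq0n d) dD) /= (big_cat_nat (leq0n d) dD) /=.
rewrite [X in _ = X + _]big_nat_cond [X in _ = X + _]big1 ?add0r => [|k]; last first.
  by rewrite andbT => /andP[_ ->].
rewrite addrAC subrr add0r big_nat_cond [RHS]big_nat_cond.
by apply: eq_bigr => k /andP[/andP[dk _] _]; rewrite ltnNge dk.
Unshelve. all: by end_near. Qed.

(** Removing the low-degree coefficients subtracts a partial sum and preserves absolute convergence;
    this isolates the remainder. *)
Lemma mpseries_drop a t (s : K) (d : nat) : mpseries_sums_to a t s ->
  mpseries_sums_to (fun m => if (mdegree m < d)%N then 0 else a m) t
    (s - series (homogeneous_part a t) d).
Proof.
move=> [a_abs a_s]; split.
  rewrite (_ : (fun m => `|_|) = fun m => if (mdegree m < d)%N then 0 else `|a m|).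
    rewrite homogeneous_part_drop; exact: cvgP (cvg_series_drop a_abs).
  by apply/funext => m; case: ifP; rewrite ?normr0.
rewrite homogeneous_part_drop; exact: cvg_series_drop.
Qed.

End TruncatedPowerSeries.

(** * Adjoints and the Heisenberg picture *)

Section Adjoint.
Variable R : realType.
Local Notation C := R[i].

Lemma conjC_real (r : R) : Num.conj (r%:C : C) = r%:C.
Proof. exact: conjc_real. Qed.

Lemma adj_mul m n p (A : 'M[C]_(m, n)) (B : 'M[C]_(n, p)) :
  (A *m B)^t* = B^t* *m A^t*.
Proof. by rewrite trmx_mul map_mxM. Qed.

Lemma adj_exp n (A : 'M[C]_n) k : (A ^+ k)^t* = A^t* ^+ k.
Proof.
elim: k => [|k IHk]; first by rewrite !expr0 trmx1 map_mx1.
by rewrite exprS -mulmxE adj_mul IHk exprSr.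
Qed.

Lemma opp_i_real (x : R) : - ('i%C * x%:C) = (0 -i* x) :> C.
Proof.
by apply/eqP; rewrite eq_complex /= !(mul0r, mul1r, mulr0, subr0, addr0, add0r, oppr0) !eqxx.
Qed.

Lemma adj_scale_i n (A : 'M[C]_n) (x : R) :
  (- ('i%C * x%:C) *: A)^t* = ('i%C * x%:C) *: A^t*.
Proof.
rewrite linearZ map_mxZ; congr (_ *: _); rewrite opp_i_real -[RHS]opprK opp_i_real.
by apply/eqP; rewrite eq_complex /= oppr0 !eqxx.
Qed.

(** The identity holds for the truncated exponentials and passes to the limit because conjugation is
    an isometry. *)
Lemma adj_expmx n (A : 'M[C]_n) : (expmx A)^t* = expmx (A^t*).
Proof.
pose P (B : 'M[C]_n) D := \sum_(k < D) (k`!%:R)^-1 *: B ^+ k.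
have PE D i j : P (A^t*) D i j = Num.conj (P A D j i).
  rewrite /P [in LHS]summxE [in RHS]summxE (rmorph_sum Num.conj); apply: eq_bigr => k _.
  by rewrite -adj_exp !mxE (rmorphM Num.conj) fmorphV rmorph_nat.
apply/matrixP => i j; rewrite [LHS]mxE [X in _ X = _]mxE.
have Kc := @abs_complete_complex R; have Ke := @exp_bounded_complex R.
have := @cvg_isometry C Num.conj _ _ (@norm_conjC C) (@cvg_expmx _ _ Kc Ke A j i).
have := @cvg_expmx _ _ Kc Ke (A^t*) i j.
rewrite -/(P (A^t*)) -/(P A) (_ : (fun D => P (A^t*) D i j) = Num.conj \o (fun D => P A D j i)).
  by move=> eA' eA; apply: (cvg_unique _ eA eA').
by apply/funext => D; rewrite PE.
Qed.

End Adjoint.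

Section Operators.
Variables (R : realType) (n : nat).
Local Notation C := R[i].
Implicit Types (c : bits n -> R) (A : operator R n) (psi : state R n).

Lemma ketbraE (x y : bits n) :
  ketbra R x y = delta_mx (enum_rank x) (enum_rank y).
Proof. by rewrite /ketbra /ket trmx_delta map_delta_mx mul_delta_mx. Qed.

Lemma flipK j : involutive (@flip n j).
Proof. by move=> x; apply/ffunP => k; rewrite !ffunE; case: eqP; rewrite ?negbK. Qed.

Lemma tr_pauliX j : (pauliX R j)^T = pauliX R j :> operator R n.
Proof.
rewrite /pauliX linear_sum /= (reindex_inj (inv_inj (flipK j))) /=.
by apply: eq_bigr => x _; rewrite !ketbraE trmx_delta flipK.
Qed.

Lemma tr_mixer : (mixer R n)^T = mixer R n.
Proof. by rewrite /mixer linear_sum /=; apply: eq_bigr => j _; rewrite tr_pauliX. Qed.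

Lemma tr_costH c : (costH c)^T = costH c.
Proof.
rewrite /costH linear_sum /=; apply: eq_bigr => x _.
by rewrite linearZ /= ketbraE trmx_delta.
Qed.

Lemma conj_mixer : map_mx Num.conj (mixer R n) = mixer R n.
Proof.
rewrite /mixer map_mx_sum; apply: eq_bigr => j _; rewrite /pauliX map_mx_sum.
by apply: eq_bigr => x _; rewrite ketbraE map_delta_mx.
Qed.

Lemma conj_costH c : map_mx Num.conj (costH c) = costH c.
Proof.
rewrite /costH map_mx_sum; apply: eq_bigr => x _.
by rewrite map_mxZ ketbraE map_delta_mx; congr (_ *: _); exact: conjC_real.
Qed.

Lemma adj_mixer : (mixer R n)^t* = mixer R n.
Proof. by rewrite tr_mixer conj_mixer. Qed.

Lemma adj_costH c : (costH c)^t* = costH c.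
Proof. by rewrite tr_costH conj_costH. Qed.

Lemma expectation_evolve A psi (H : operator R n) (x : R) : H^t* = H ->
  Defs.expectation (expmx ((0 -i* x) *: H) *m psi) A =
  Defs.expectation psi (heisenberg ('i%C * x%:C) H A).
Proof.
move=> H_adj; rewrite /Defs.expectation /heisenberg adj_mul adj_expmx.
rewrite -opp_i_real.
by rewrite adj_scale_i H_adj !mulmxA.
Qed.

(** Evolving the observable reverses the nesting: the last layer acts innermost, on the cost, and
    the first one outermost. The induction moves one layer at a time and therefore varies the
    initial state. *)
Lemma qaoa_expectation_heisenberg p c (gamma beta : 'I_p -> R) :
  qaoa_expectation c gamma beta =
  expect0 (foldr (fun j A => heisenberg ('i%C * (gamma j)%:C) (costH c)
     (heisenberg ('i%C * (beta j)%:C) (mixer R n) A)) (costH c) (enum 'I_p)).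
Proof.
rewrite /qaoa_expectation /qaoa_state /expect0.
elim: (enum _) (uniform_state R n) => [//|j s IHs] psi /=.
by rewrite IHs !expectation_evolve // ?adj_mixer // adj_costH.
Qed.

Lemma expect0_sum (I : finType) (a : I -> C) (A : I -> operator R n) :
  expect0 (\sum_i a i *: A i) = \sum_i a i * expect0 (A i).
Proof.
rewrite /expect0; move: (uniform_state R n) => s.
rewrite /Defs.expectation mulmx_sumr mulmx_suml summxE.
by apply: eq_bigr => i _; rewrite -scalemxAr -scalemxAl mxE.
Qed.

End Operators.

Lemma sum_ffun_sumType (V : nmodType) (I J : finType)
    (G : (I -> J) -> (I -> J) -> V) :
  \sum_(m : {ffun I + I -> J}) G (fun i => m (inl i)) (fun i => m (inr i)) =
  \sum_(f : {ffun I -> J * J}) G (fun i => (f i).1) (fun i => (f i).2).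
Proof.
rewrite (reindex (fun f : {ffun I -> J * J} =>
  [ffun i : I + I => match i with inl i => (f i).1 | inr i => (f i).2 end])) /=.
  by apply: eq_bigr => f _; congr G; apply/funext => i; rewrite ffunE.
exists (fun m : {ffun I + I -> J} => [ffun i => (m (inl i), m (inr i))]) => [f _|m _].
  by apply/ffunP => i; rewrite !ffunE -surjective_pairing.
by apply/ffunP => -[i|i]; rewrite !ffunE.
Qed.

(** * Coefficients of the power series in the angles, and its absolute convergence *)

Section Coefficients.
Variables (R : realType) (n p : nat).
Local Notation C := R[i].
Implicit Types (c : bits n -> R) (m : 'I_p + 'I_p -> nat).

Definition multi_word m : seq gradient :=
  layer_word (fun j => m (inl j)) (fun j => m (inr j)).

Lemma size_multi_word m : size (multi_word m) = mdegree m.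
Proof.
rewrite /multi_word /layer_word /mdegree big_sumType /= -big_split /=.
rewrite size_flatten /shape -map_comp sumnE big_map big_enum /=.
by apply: eq_bigr => j _; rewrite size_cat !size_nseq.
Qed.

Definition multi_coef m : C := 'i%C ^+ mdegree m / \prod_i (m i)`!%:R.

Definition full_coef c m : C := multi_coef m * expect0 (iterated_commutator c (multi_word m)).

Definition gradient_coef m : gradient_comb R :=
  if (mdegree m < 6)%N then [::] else [:: (multi_coef m, multi_word m)].

Lemma eval_gradient_coef c m :
  eval_comb c (gradient_coef m) = if (mdegree m < 6)%N then 0 else full_coef c m.
Proof.
by rewrite /eval_comb /gradient_coef; case: ifP; rewrite ?big_nil ?big_seq1.
Qed.

Lemma multi_coef_monomial m (t : 'I_p + 'I_p -> C) (x : C) :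
  x / (\prod_i (m i)`!%:R) * \prod_i t i ^+ m i =
  x * \prod_j (t (inl j) ^+ m (inl j) / (m (inl j))`!%:R *
     (t (inr j) ^+ m (inr j) / (m (inr j))`!%:R)).
Proof.
rewrite -mulrA -prodfV; congr (_ * _).
rewrite -big_split big_sumType /= -big_split /=; apply: eq_bigr => j _.
by congr (_ * _); rewrite mulrC.
Qed.

Lemma prod_angle_scale m (t : 'I_p + 'I_p -> C) :
  'i%C ^+ mdegree m * \prod_i t i ^+ m i = \prod_i ('i%C * t i) ^+ m i.
Proof.
rewrite /mdegree -prodrXr -big_split; apply: eq_bigr => i _.
by rewrite exprMn.
Qed.

(** The power of i in each coefficient is distributed over the variables, turning the angles into
    the imaginary arguments of [heisenberg]. *)
Lemma box_sum_full_coef c (t : 'I_p + 'I_p -> C) D :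
  box_sum (full_coef c) t D =
  expect0 (word_sum D (fun j => 'i%C * t (inl j)) (fun j => 'i%C * t (inr j))
    (iterated_commutator c)).
Proof.
rewrite /word_sum expect0_sum -(@sum_ffun_sumType _ _ _ (fun k l : 'I_p -> 'I_D =>
  (\prod_j (('i%C * t (inl j)) ^+ k j / (k j)`!%:R * (('i%C * t (inr j)) ^+ l j / (l j)`!%:R))) *
  expect0 (iterated_commutator c (layer_word (fun j => k j) (fun j => l j))))).
apply: eq_bigr => m _.
rewrite /full_coef /multi_coef mulrAC; congr (_ * _).
rewrite -mulrA mulrCA mulrC prod_angle_scale.
by rewrite mulrC -[_^-1]mul1r multi_coef_monomial mul1r.
Qed.

Lemma entry_norm_bracket N (H Y : 'M[C]_N) :
  entry_norm (bracket H Y) <= 2 * entry_norm H * entry_norm Y.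
Proof.
apply: le_trans (entry_normD _ _) _; rewrite entry_normN -mulrA mulr_natl mulr2n.
apply: lerD; first exact: entry_norm_mul.
by rewrite [leRHS]mulrC; exact: entry_norm_mul.
Qed.

(** Each letter is a commutator with B or C and multiplies the norm by at most 2|B| + 2|C|; K0
    collects the cost operator and the two copies of the state. *)
Lemma expect0_word_bound c : exists M K0 : C, [/\ 0 <= M, 0 <= K0 &
  forall w, `|expect0 (iterated_commutator c w)| <= K0 * M ^+ size w].
Proof.
set s := uniform_state R n.
pose M := 2 * entry_norm (mixer R n) + 2 * entry_norm (costH c).
have ge0 k l (A : 'M[C]_(k, l)) : 0 <= entry_norm A := entry_norm_ge0 A.
have M0 : 0 <= M by rewrite addr_ge0 // mulr_ge0.
exists M, (entry_norm (s^t*) * entry_norm (costH c) * entry_norm s).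
split => //; first by rewrite !mulr_ge0.
move=> w; apply: le_trans (le_entry_norm _ _ _) _.
apply: le_trans (entry_norm_mul _ _) _.
rewrite mulrAC ler_wpM2r //; apply: le_trans (entry_norm_mul _ _) _.
rewrite -mulrA ler_wpM2l //.
elim: w => [|g w IHw]; first by rewrite mulr1.
have step (H : operator R n) : 2 * entry_norm H <= M ->
    entry_norm (bracket H (iterated_commutator c w)) <= entry_norm (costH c) * M ^+ (size w).+1.
  move=> HM; apply: le_trans (entry_norm_bracket _ _) _.
  by rewrite exprS mulrCA ler_pM // mulr_ge0.
by case: g; apply: step; rewrite ?lerDl ?lerDr mulr_ge0.
Qed.

Lemma sum_box_prod (F : comNzRingType) (I : finType) (h : I -> nat -> F) D :
  \sum_(m : {ffun I -> 'I_D}) \prod_i h i (m i) = \prod_i \sum_(k < D) h i k.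
Proof. by rewrite bigA_distr_bigA. Qed.

Lemma box_sum_full_coef_bounded c (t : 'I_p + 'I_p -> C) :
  exists M : C, forall D, box_sum (fun m => `|full_coef c m|) (fun i => `|t i|) D <= M.
Proof.
have [M [K0 [M0 K00 wM]]] := expect0_word_bound c.
have [E EP] := choice (fun i => exp_bounded_complex (mulr_ge0 M0 (normr_ge0 (t i)))).
exists (K0 * \prod_i E i) => D.
(* Geometric growth factors over the variables, so the box sum is dominated by a product of
   truncated exponentials of M |t_i|. *)
apply: (@le_trans _ _ (K0 * \prod_i \sum_(k < D) (M * `|t i|) ^+ k / k`!%:R)); last first.
  rewrite ler_wpM2l // ler_prod // => i _.
  apply/andP; split; last exact: EP.
  by apply: sumr_ge0 => k _; rewrite divr_ge0 // exprn_ge0 // mulr_ge0.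
rewrite -(sum_box_prod (fun i k => (M * `|t i|) ^+ k / k`!%:R) D) mulr_sumr; apply: ler_sum => m _.
rewrite /full_coef /multi_coef !normrM normfV normr_prod normrX.
have -> : `|'i%C| = 1 :> C by rewrite normc_def /= expr0n expr1n add0r sqrtr1.
rewrite expr1n mul1r.
apply: (@le_trans _ _ ((\prod_i `|(m i)`!%:R|)^-1 * (K0 * M ^+ mdegree (fun i => m i)) *
  \prod_i `|t i| ^+ m i)).
  rewrite ler_wpM2r ?prodr_ge0 //.
  rewrite ler_wpM2l ?invr_ge0 ?prodr_ge0 //.
  by rewrite -size_multi_word; apply: wM.
rewrite le_eqVlt; apply/orP; left; apply/eqP.
rewrite mulrCA -!mulrA; congr (_ * _).
rewrite /mdegree -prodrXr -prodfV -!big_split; apply: eq_bigr => i _ /=.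
by rewrite normr_nat exprMn mulrC.
Qed.

Lemma cvg_expect0 (u : nat -> operator R n) A :
  cvg_mx u A -> (fun D => expect0 (u D) : Num.NumField.sort C) @ \oo -->
  (expect0 A : Num.NumField.sort C).
Proof.
move=> uA.
have expect0E B : expect0 B =
    \sum_(ij : _ * _) B ij.1 ij.2 * expect0 (delta_mx ij.1 ij.2 : operator R n).
  by rewrite {1}[B]matrix_sum_delta_pair expect0_sum.
rewrite expect0E (funext (fun D => expect0E (u D))).
by apply: cvg_bigsum => ij; apply: cvgM; [exact: uA|exact: cvg_cst].
Qed.

Lemma full_coef_sums_to c (gamma beta : 'I_p -> R) :
  mpseries_sums_to (full_coef c) (angles gamma beta) (qaoa_expectation c gamma beta).
Proof.
have [M boxM] := box_sum_full_coef_bounded c (angles gamma beta).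
apply: (box_sum_sums_to (@abs_complete_complex R) boxM).
rewrite qaoa_expectation_heisenberg (funext (box_sum_full_coef c (angles gamma beta))).
exact: cvg_expect0 (@cvg_word_sum _ _ _ (fun j => 'i%C * (gamma j)%:C)
  (fun j => 'i%C * (beta j)%:C) c).
Qed.

(** Here the power of i stays with the word instead of moving into the angles. The angles remain
    real, so the coefficients of words can be computed over R. *)
Lemma series_full_coef c (gamma beta : 'I_p -> R) d :
  series (homogeneous_part (full_coef c) (angles gamma beta)) d =
  word_sum d (fun j => (gamma j)%:C) (fun j => (beta j)%:C)
    (fun w => if (size w < d)%N then 'i%C ^+ size w * expect0 (iterated_commutator c w)
              else 0 : C^o).
Proof.
rewrite series_homogeneous_part big_mkcond /word_sum.
rewrite -(@sum_ffun_sumType _ _ _ (fun k l : 'I_p -> 'I_d =>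
  (\prod_j ((gamma j)%:C ^+ k j / (k j)`!%:R * ((beta j)%:C ^+ l j / (l j)`!%:R))) *:
  (let w := layer_word (fun j => k j) (fun j => l j) in
   if (size w < d)%N then 'i%C ^+ size w * expect0 (iterated_commutator c w) else 0 : C^o))).
apply: eq_bigr => m _ /=; rewrite -/(multi_word (fun i => m i)) size_multi_word.
case: ifP => _; last by rewrite scaler0.
rewrite /full_coef /multi_coef mulrAC.
rewrite multi_coef_monomial mulrAC.
exact: mulrC.
Qed.

End Coefficients.

(** * Gradient expectations of order less than six *)

(** By Jacobi, the difference of the two sides is the bracket of [H,K] with itself. *)
Lemma double_bracketC (F : comPzRingType) N (H K : 'M[F]_N) :
  H *m (K *m (H *m K - K *m H) - (H *m K - K *m H) *m K) -
  (K *m (H *m K - K *m H) - (H *m K - K *m H) *m K) *m H =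
  K *m (H *m (H *m K - K *m H) - (H *m K - K *m H) *m H) -
  (H *m (H *m K - K *m H) - (H *m K - K *m H) *m H) *m K.
Proof.
rewrite !(mulmxBr, mulmxBl) !mulmxA; apply/matrixP => i j.
(* Only sums and opposites are evaluated entrywise; the products of matrices stay as atoms for
   [ring]. *)
have addE (A B : 'M[F]_N) : (A + B) i j = A i j + B i j by rewrite mxE.
have oppE (A : 'M[F]_N) : (- A) i j = - A i j by rewrite mxE.
rewrite !(addE, oppE); ring.
Qed.

Section GradientExpectations.
Variables (R : realType) (n : nat).
Local Notation C := R[i].
Implicit Types (c : bits n -> R) (A : operator R n).
Local Notation s := (uniform_state R n).

Lemma tr_uniform_state : s^t* = s^T.
Proof.
rewrite /uniform_state linearZ map_mxZ; congr (_ *: _); first exact: conjC_real.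
rewrite linear_sum map_mx_sum; apply: eq_bigr => x _.
by rewrite /= /ket trmx_delta map_delta_mx.
Qed.

(** Each X_j permutes the basis vectors, hence fixes their sum. *)
Lemma mixer_uniform_state : mixer R n *m s = n%:R *: s.
Proof.
rewrite /uniform_state -scalemxAr scalerA mulrC -scalerA; congr (_ *: _).
rewrite /mixer mulmx_suml; transitivity (\sum_(j < n) \sum_(x : bits n) ket R x).
  apply: eq_bigr => j _; rewrite /pauliX mulmx_suml.
  rewrite [RHS](reindex_inj (inv_inj (@flipK n j))); apply: eq_bigr => x _.
  rewrite mulmx_sumr (bigD1 x) //= ketbraE /ket mul_delta_mx big1 ?addr0 // => y yx.
  by rewrite mul_delta_mx_cond (inj_eq enum_rank_inj) eq_sym (negPf yx).
by rewrite sumr_const card_ord scaler_nat.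
Qed.

Lemma expect0_nabla A : expect0 (nabla A) = 0.
Proof.
rewrite /expect0 /Defs.expectation /nabla /commutator.
have sB : s^t* *m mixer R n = n%:R *: s^t*.
  by rewrite tr_uniform_state -{1}tr_mixer -trmx_mul mixer_uniform_state linearZ.
rewrite mulmxBr mulmxBl !mulmxA sB -!mulmxA mixer_uniform_state.
by rewrite -!scalemxAl -!scalemxAr subrr mxE.
Qed.

Lemma expect0_tr A : expect0 A^T = expect0 A.
Proof.
rewrite /expect0 /Defs.expectation tr_uniform_state.
have -> : s^T *m A^T *m s = (s^T *m A *m s)^T by rewrite !trmx_mul trmxK mulmxA.
by rewrite mxE.
Qed.

(** B and C are symmetric and transposition reverses products, so every commutator contributes one
    sign. *)
Lemma tr_iterated_commutator c w :
  (iterated_commutator c w)^T = (-1) ^+ size w *: iterated_commutator c w.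
Proof.
elim: w => [|g w IHw]; first by rewrite scale1r tr_costH.
have step (H : operator R n) : H^T = H ->
    (commutator H (iterated_commutator c w))^T =
    (-1) ^+ (size w).+1 *: commutator H (iterated_commutator c w).
  move=> H_tr; rewrite /commutator linearB /= !trmx_mul H_tr IHw.
  by rewrite -scalemxAl -scalemxAr -scalerBr exprS -scalerA scaleN1r -scalerN opprB.
by case: g; apply: step; [exact: tr_mixer | exact: tr_costH].
Qed.

Lemma expect0_odd c w : odd (size w) -> expect0 (iterated_commutator c w) = 0.
Proof.
move=> w_odd; suff : expect0 (iterated_commutator c w) *+ 2 == 0.
  by rewrite mulrn_eq0 => /eqP.
rewrite mulr2n -{1}expect0_tr tr_iterated_commutator -signr_odd w_odd expr1 scaleN1r.
by rewrite /expect0 /Defs.expectation mulmxN mulNmx mxE addNr.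
Qed.

Lemma iterated_commutator_rcons c w : iterated_commutator c (rcons w NablaC) = 0.
Proof.
rewrite /iterated_commutator foldr_rcons /nablaC /commutator subrr.
by elim: w => [//|g w /= ->]; case: g; rewrite /nabla /commutator mulmx0 mul0mx subrr.
Qed.

Lemma expect0_rcons c w : expect0 (iterated_commutator c (rcons w NablaC)) = 0.
Proof.
by rewrite iterated_commutator_rcons /expect0 /Defs.expectation mulmx0 mul0mx mxE.
Qed.

Lemma iterated_commutator_swap c w :
  iterated_commutator c (w ++ [:: Nabla; NablaC; Nabla]) =
  iterated_commutator c (w ++ [:: NablaC; Nabla; Nabla]).
Proof.
rewrite /iterated_commutator !foldr_cat; congr (foldr _ _ w).
exact: (double_bracketC (mixer R n) (costH c)).
Qed.

End GradientExpectations.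

(** * Coefficients of words as sums over ordered indices *)

Section ChainSums.
Variable F : fieldType.

Definition chain_rel (strict : bool) (i j : nat) : bool :=
  if strict then (i < j)%N else (i <= j)%N.

(* [chain_sum f [:: (b1, g); (b2, h); ...]] is the sum of f i * g j * h k ...
   over i R1 j R2 k ..., where R is < or <= according to the flag b in front of
   the larger index. *)
Fixpoint chain p (f : 'I_p -> F) (L : seq (bool * ('I_p -> F))) (i : 'I_p) : F :=
  if L is (b, g) :: L' then f i * \sum_(j < p | chain_rel b i j) chain g L' j else f i.

Definition chain_sum p (f : 'I_p -> F) L : F := \sum_i chain f L i.

Definition tail p (f : 'I_p.+1 -> F) : 'I_p -> F := fun j => f (lift ord0 j).

Definition tails p (L : seq (bool * ('I_p.+1 -> F))) : seq (bool * ('I_p -> F)) :=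
  [seq (x.1, tail x.2) | x <- L].

Lemma chain_lift p (f : 'I_p.+1 -> F) L i :
  chain f L (lift ord0 i) = chain (tail f) (tails L) i.
Proof.
elim: L f i => [//|[b g] L IHL] f i /=; congr (_ * _).
rewrite big_mkcond big_ord_recl /= [X in X + _](_ : _ = 0) ?add0r; last by case: b.
rewrite [RHS]big_mkcond; apply: eq_bigr => j _.
by rewrite IHL; case: b.
Qed.

(** Either all indices are positive, or the smallest one is 0. In the latter case a strict relation
    forces the next index to be positive, while a weak one leaves it free. This matches peeling off
    the first layer. *)
Lemma chain_sumS p (f : 'I_p.+1 -> F) L :
  chain_sum f L = chain_sum (tail f) (tails L) +
    f ord0 * (if L is (b, g) :: L' then
                if b then chain_sum (tail g) (tails L') else chain_sum g L'
              else 1).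
Proof.
rewrite /chain_sum big_ord_recl addrC; congr (_ + _).
  by apply: eq_bigr => i _; rewrite chain_lift.
case: L => [|[[] g] L] /=; rewrite ?mulr1 //; congr (_ * _).
rewrite big_mkcond big_ord_recl /= add0r.
by apply: eq_bigr => i _; rewrite chain_lift.
Qed.

Lemma chain_sum0 (f : 'I_0 -> F) L : chain_sum f L = 0.
Proof. exact: big_ord0. Qed.

Lemma chain_sum2E b1 p (f g : 'I_p -> F) :
  chain_sum f [:: (b1, g)] = \sum_(i < p) \sum_(j < p | chain_rel b1 i j) f i * g j.
Proof. by apply: eq_bigr => i _; rewrite /= mulr_sumr. Qed.

Lemma chain_sum3E b1 b2 p (f g h : 'I_p -> F) :
  chain_sum f [:: (b1, g); (b2, h)] =
  \sum_(i < p) \sum_(j < p) \sum_(k < p | chain_rel b1 i j && chain_rel b2 j k) f i * g j * h k.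
Proof.
apply: eq_bigr => i _; rewrite /= mulr_sumr big_mkcond; apply: eq_bigr => j _.
case: ifP => ij; last by rewrite big_pred0.
by rewrite !mulr_sumr; apply: eq_bigr => k _; rewrite mulrA.
Qed.

Lemma chain_sum4E b1 b2 b3 p (f g h e : 'I_p -> F) :
  chain_sum f [:: (b1, g); (b2, h); (b3, e)] =
  \sum_(i < p) \sum_(j < p) \sum_(k < p)
    \sum_(l < p | [&& chain_rel b1 i j, chain_rel b2 j k & chain_rel b3 k l])
      f i * g j * h k * e l.
Proof.
apply: eq_bigr => i _; rewrite /= mulr_sumr big_mkcond; apply: eq_bigr => j _.
case: ifP => ij; last by rewrite big1 // => k _; rewrite big_pred0.
rewrite !mulr_sumr big_mkcond; apply: eq_bigr => k _.
case: ifP => jk; last by rewrite big_pred0.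
by rewrite !mulr_sumr; apply: eq_bigr => l _; rewrite !mulrA.
Qed.

End ChainSums.

Definition bool_of_gradient (g : gradient) : bool := if g is Nabla then true else false.
Definition gradient_of_bool (b : bool) : gradient := if b then Nabla else NablaC.
Lemma bool_of_gradientK : cancel bool_of_gradient gradient_of_bool.
Proof. by case. Qed.
HB.instance Definition _ := Equality.copy gradient (can_type bool_of_gradientK).

(** Prefix removal by recursion on the letters: on concrete words it computes, so simplification
    discards the layers that do not match. *)
Fixpoint strip (u w : seq gradient) : option (seq gradient) :=
  match u, w with
  | [::], _ => Some w
  | NablaC :: u', NablaC :: w' => strip u' w'
  | Nabla :: u', Nabla :: w' => strip u' w'
  | _, _ => None
  end.

Lemma eq_cat_strip u v w :
  (u ++ v == w) = if strip u w is Some w' then v == w' else false.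
Proof.
elim: u w => [//|[] u IHu] [|[] w] //=; rewrite -IHu;
  by apply/eqP/eqP => [[->]|->].
Qed.

Section WordCoefficients.
Variable F : numFieldType.

(* The bound 6 on the exponents is harmless for words of length < 6. *)
Definition word_coef p (gamma beta : 'I_p -> F) (w0 : seq gradient) : F :=
  word_sum 6 gamma beta (fun w => (w == w0)%:R : F^o).

Lemma word_coef0 (gamma beta : 'I_0 -> F) w0 : word_coef gamma beta w0 = (w0 == [::])%:R.
Proof. by rewrite /word_coef word_sum0 eq_sym. Qed.

(** The first layer must spell a prefix of the word, and the remaining layers spell the rest. *)
Lemma word_coefS p (gamma beta : 'I_p.+1 -> F) w0 :
  word_coef gamma beta w0 = \sum_(k < 6) \sum_(l < 6)
    (gamma ord0 ^+ k / k`!%:R * (beta ord0 ^+ l / l`!%:R)) *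
    oapp (word_coef (tail gamma) (tail beta)) 0 (strip (nseq k NablaC ++ nseq l Nabla) w0).
Proof.
rewrite /word_coef word_sumS; apply: eq_bigr => k _; apply: eq_bigr => l _.
congr (_ * _).
rewrite /word_sum; case E: (strip _ _) => [v|] /=; last first.
  by apply: big1 => f _; rewrite catA eq_cat_strip E scaler0.
by apply: eq_bigr => f _; rewrite catA eq_cat_strip E.
Qed.

Lemma sum6 (T : nat -> nat -> F) : \sum_(k < 6) \sum_(l < 6) T k l =
   (T 0 0 + T 0 1 + T 0 2 + T 0 3 + T 0 4 + T 0 5)
 + (T 1 0 + T 1 1 + T 1 2 + T 1 3 + T 1 4 + T 1 5)
 + (T 2 0 + T 2 1 + T 2 2 + T 2 3 + T 2 4 + T 2 5)
 + (T 3 0 + T 3 1 + T 3 2 + T 3 3 + T 3 4 + T 3 5)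
 + (T 4 0 + T 4 1 + T 4 2 + T 4 3 + T 4 4 + T 4 5)
 + (T 5 0 + T 5 1 + T 5 2 + T 5 3 + T 5 4 + T 5 5).
Proof. by rewrite !big_ord_recr !big_ord0 /= !add0r. Qed.

Ltac word_coef_step := rewrite word_coefS
 (@sum6 (fun k l => (_ ^+ k / k`!%:R * (_ ^+ l / l`!%:R)) *
    oapp (word_coef _ _) 0 (strip (nseq k NablaC ++ nseq l Nabla) _))) /=
  !(mulr0, addr0).

Definition fexp p (f : 'I_p -> F) (k : nat) : 'I_p -> F := fun j => f j ^+ k.

Lemma tail_fexp p (f : 'I_p.+1 -> F) k : tail (fexp f k) = fexp (tail f) k.
Proof. by []. Qed.

Lemma fexpE p (f : 'I_p -> F) k j : fexp f k j = f j ^+ k.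
Proof. by []. Qed.

Lemma fact_small : ((0`! = 1%N) * (1`! = 1%N) * (2`! = 2%N) * (3`! = 6%N))%type.
Proof. by []. Qed.

Ltac word_coef_close := rewrite !chain_sumS /= ?tail_fexp ?fexpE ?fact_small; by field.

(** Peeling a layer off a word leaves one of its suffixes, so the formulas are established suffix by
    suffix, each by induction on p. *)
Lemma word_coef_nil p (gamma beta : 'I_p -> F) : word_coef gamma beta [::] = 1.
Proof.
elim: p gamma beta => [|p IHp] gamma beta; first by rewrite word_coef0.
by word_coef_step; rewrite IHp ?fact_small !expr0 !divr1 !mulr1.
Qed.

(* In the names below, c stands for the letter [NablaC] and b for [Nabla]. *)
Lemma word_coef_b p (gamma beta : 'I_p -> F) :
  word_coef gamma beta [:: Nabla] =
  chain_sum beta [::].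
Proof.
elim: p gamma beta => [|p IHp] gamma beta.
  by rewrite word_coef0 !chain_sum0 /= ?(mulr0, addr0).
word_coef_step; rewrite IHp word_coef_nil.
word_coef_close.
Qed.

Lemma word_coef_bb p (gamma beta : 'I_p -> F) :
  word_coef gamma beta [:: Nabla; Nabla] =
  chain_sum beta [:: (true, beta)] + 2^-1 * chain_sum (fexp beta 2) [::].
Proof.
elim: p gamma beta => [|p IHp] gamma beta.
  by rewrite word_coef0 !chain_sum0 /= ?(mulr0, addr0).
word_coef_step; rewrite IHp word_coef_b word_coef_nil.
word_coef_close.
Qed.

Lemma word_coef_bbb p (gamma beta : 'I_p -> F) :
  word_coef gamma beta [:: Nabla; Nabla; Nabla] =
  chain_sum beta [:: (true, beta); (true, beta)]
  + 2^-1 * (chain_sum (fexp beta 2) [:: (true, beta)] + chain_sum beta [:: (true, fexp beta 2)])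
  + 6^-1 * chain_sum (fexp beta 3) [::].
Proof.
elim: p gamma beta => [|p IHp] gamma beta.
  by rewrite word_coef0 !chain_sum0 /= ?(mulr0, addr0).
word_coef_step; rewrite IHp word_coef_bb word_coef_b word_coef_nil.
word_coef_close.
Qed.

(** Within a layer [NablaC] precedes [Nabla]. Thus the index may stay put when passing from c to b,
    but must increase from b to c. *)
Lemma word_coef_cb p (gamma beta : 'I_p -> F) :
  word_coef gamma beta [:: NablaC; Nabla] =
  chain_sum gamma [:: (false, beta)].
Proof.
elim: p gamma beta => [|p IHp] gamma beta.
  by rewrite word_coef0 !chain_sum0 /= ?(mulr0, addr0).
word_coef_step; rewrite IHp word_coef_b word_coef_nil.
word_coef_close.
Qed.

Lemma word_coef_cbb p (gamma beta : 'I_p -> F) :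
  word_coef gamma beta [:: NablaC; Nabla; Nabla] =
  chain_sum gamma [:: (false, beta); (true, beta)]
  + 2^-1 * chain_sum gamma [:: (false, fexp beta 2)].
Proof.
elim: p gamma beta => [|p IHp] gamma beta.
  by rewrite word_coef0 !chain_sum0 /= ?(mulr0, addr0).
word_coef_step; rewrite IHp word_coef_bb word_coef_b word_coef_nil.
word_coef_close.
Qed.

Lemma word_coef_cbbb p (gamma beta : 'I_p -> F) :
  word_coef gamma beta [:: NablaC; Nabla; Nabla; Nabla] =
  chain_sum gamma [:: (false, beta); (true, beta); (true, beta)]
  + 2^-1 * (chain_sum gamma [:: (false, fexp beta 2); (true, beta)]
            + chain_sum gamma [:: (false, beta); (true, fexp beta 2)])
  + 6^-1 * chain_sum gamma [:: (false, fexp beta 3)].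
Proof.
elim: p gamma beta => [|p IHp] gamma beta.
  by rewrite word_coef0 !chain_sum0 /= ?(mulr0, addr0).
word_coef_step; rewrite IHp word_coef_bbb word_coef_bb word_coef_b word_coef_nil.
word_coef_close.
Qed.

Lemma word_coef_ccb p (gamma beta : 'I_p -> F) :
  word_coef gamma beta [:: NablaC; NablaC; Nabla] =
  chain_sum gamma [:: (true, gamma); (false, beta)]
  + 2^-1 * chain_sum (fexp gamma 2) [:: (false, beta)].
Proof.
elim: p gamma beta => [|p IHp] gamma beta.
  by rewrite word_coef0 !chain_sum0 /= ?(mulr0, addr0).
word_coef_step; rewrite IHp word_coef_cb word_coef_b word_coef_nil.
word_coef_close.
Qed.

Lemma word_coef_cccb p (gamma beta : 'I_p -> F) :
  word_coef gamma beta [:: NablaC; NablaC; NablaC; Nabla] =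
  chain_sum gamma [:: (true, gamma); (true, gamma); (false, beta)]
  + 2^-1 * (chain_sum (fexp gamma 2) [:: (true, gamma); (false, beta)]
            + chain_sum gamma [:: (true, fexp gamma 2); (false, beta)])
  + 6^-1 * chain_sum (fexp gamma 3) [:: (false, beta)].
Proof.
elim: p gamma beta => [|p IHp] gamma beta.
  by rewrite word_coef0 !chain_sum0 /= ?(mulr0, addr0).
word_coef_step; rewrite IHp word_coef_ccb word_coef_cb word_coef_b word_coef_nil.
word_coef_close.
Qed.

(** Equal letters taken from the same layer merge into a power over a factorial; 1/4 is 1/2 for the
    pair of c times 1/2 for the pair of b. *)
Lemma word_coef_ccbb p (gamma beta : 'I_p -> F) :
  word_coef gamma beta [:: NablaC; NablaC; Nabla; Nabla] =
  chain_sum gamma [:: (true, gamma); (false, beta); (true, beta)]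
  + 2^-1 * chain_sum (fexp gamma 2) [:: (false, beta); (true, beta)]
  + 2^-1 * chain_sum gamma [:: (true, gamma); (false, fexp beta 2)]
  + 4^-1 * chain_sum (fexp gamma 2) [:: (false, fexp beta 2)].
Proof.
elim: p gamma beta => [|p IHp] gamma beta.
  by rewrite word_coef0 !chain_sum0 /= ?(mulr0, addr0).
word_coef_step; rewrite IHp word_coef_cbb word_coef_bb word_coef_b word_coef_nil.
word_coef_close.
Qed.

Lemma word_coef_bcb p (gamma beta : 'I_p -> F) :
  word_coef gamma beta [:: Nabla; NablaC; Nabla] =
  chain_sum beta [:: (true, gamma); (false, beta)].
Proof.
elim: p gamma beta => [|p IHp] gamma beta.
  by rewrite word_coef0 !chain_sum0 /= ?(mulr0, addr0).
word_coef_step; rewrite IHp word_coef_cb.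
word_coef_close.
Qed.

(** No letter is repeated consecutively, so no powers appear. *)
Lemma word_coef_cbcb p (gamma beta : 'I_p -> F) :
  word_coef gamma beta [:: NablaC; Nabla; NablaC; Nabla] =
  chain_sum gamma [:: (false, beta); (true, gamma); (false, beta)].
Proof.
elim: p gamma beta => [|p IHp] gamma beta.
  by rewrite word_coef0 !chain_sum0 /= ?(mulr0, addr0).
word_coef_step; rewrite IHp word_coef_bcb word_coef_cb.
word_coef_close.
Qed.

End WordCoefficients.

Section ExplicitCoefficients.
Variables (F : numFieldType) (p : nat).
Implicit Types gamma beta : 'I_p -> F.

Lemma word_coef_cb_sum gamma beta :
  word_coef gamma beta [:: NablaC; Nabla] =
  \sum_(i < p) \sum_(j < p | (i <= j)%N) gamma i * beta j.
Proof. by rewrite word_coef_cb chain_sum2E. Qed.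

Lemma word_coef_cbbb_sum gamma beta :
  word_coef gamma beta [:: NablaC; Nabla; Nabla; Nabla] =
  \sum_(i < p) \sum_(j < p) \sum_(k < p)
     \sum_(l < p | [&& i <= j, j < k & k < l]%N)
       gamma i * beta j * beta k * beta l
   + 2^-1 * (\sum_(i < p) \sum_(j < p)
     \sum_(k < p | [&& i <= j & j < k]%N)
       gamma i * (beta j ^+ 2 * beta k + beta j * beta k ^+ 2))
   + (3`!)%:R^-1 * (\sum_(i < p) \sum_(j < p | (i <= j)%N)
       gamma i * beta j ^+ 3).
Proof.
rewrite word_coef_cbbb chain_sum4E !chain_sum3E chain_sum2E fact_small.
congr (_ + _ * _ + _ * _).
rewrite -big_split; apply: eq_bigr => i _; rewrite -big_split; apply: eq_bigr => j _.
by rewrite -big_split; apply: eq_bigr => k _; rewrite /= /fexp mulrDr !mulrA.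
Qed.

Lemma word_coef_cccb_sum gamma beta :
  word_coef gamma beta [:: NablaC; NablaC; NablaC; Nabla] =
  \sum_(i < p) \sum_(j < p) \sum_(k < p)
     \sum_(l < p | [&& i < j, j < k & k <= l]%N)
       gamma i * gamma j * gamma k * beta l
   + 2^-1 * (\sum_(j < p) \sum_(k < p)
     \sum_(l < p | [&& j < k & k <= l]%N)
       (gamma j ^+ 2 * gamma k + gamma j * gamma k ^+ 2) * beta l)
   + (3`!)%:R^-1 * (\sum_(i < p) \sum_(j < p | (i <= j)%N)
       gamma i ^+ 3 * beta j).
Proof.
rewrite word_coef_cccb chain_sum4E !chain_sum3E chain_sum2E fact_small.
congr (_ + _ * _ + _ * _).
rewrite -big_split; apply: eq_bigr => i _; rewrite -big_split; apply: eq_bigr => j _.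
by rewrite -big_split; apply: eq_bigr => k _; rewrite /= /fexp mulrDl.
Qed.

Lemma word_coef_ccbb_cbcb_sum gamma beta :
  word_coef gamma beta [:: NablaC; NablaC; Nabla; Nabla] +
  word_coef gamma beta [:: NablaC; Nabla; NablaC; Nabla] =
  \sum_(i < p) \sum_(j < p) \sum_(k < p)
     \sum_(l < p | [&& i < j, j <= k & k < l]%N)
       gamma i * gamma j * beta k * beta l
   + 2^-1 * (\sum_(i < p) \sum_(k < p)
     \sum_(l < p | [&& i <= k & k < l]%N)
       gamma i ^+ 2 * beta k * beta l)
   + 2^-1 * (\sum_(i < p) \sum_(j < p)
     \sum_(k < p | [&& i < j & j <= k]%N)
       gamma i * gamma j * beta k ^+ 2)
   + 4^-1 * (\sum_(i < p) \sum_(j < p | (i <= j)%N)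
       gamma i ^+ 2 * beta j ^+ 2)
   + \sum_(i < p) \sum_(j < p) \sum_(k < p)
     \sum_(l < p | [&& i <= j, j < k & k <= l]%N)
       gamma i * beta j * gamma k * beta l.
Proof.
by rewrite word_coef_ccbb word_coef_cbcb !chain_sum4E !chain_sum3E chain_sum2E.
Qed.

End ExplicitCoefficients.

Lemma word_sum_comb (F : fieldType) p D (gamma beta : 'I_p -> F)
    (e0 e1 e2 e3 e4 : F) (i0 i1 i2 i3 i4 i5 : seq gradient -> F^o) :
  word_sum D gamma beta
    (fun w => e0 * i0 w - e1 * i1 w + e2 * i2 w + e3 * i3 w + e4 * (i4 w + i5 w) : F^o) =
  e0 * word_sum D gamma beta i0 - e1 * word_sum D gamma beta i1
  + e2 * word_sum D gamma beta i2 + e3 * word_sum D gamma beta i3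
  + e4 * (word_sum D gamma beta i4 + word_sum D gamma beta i5).
Proof.
rewrite /word_sum -big_split !mulr_sumr -sumrB -!big_split; apply: eq_bigr => f _ /=.
by rewrite /GRing.scale /=; ring.
Qed.

(** * The expansion through order five *)

Section LowOrder.
Variables (R : realType) (n p : nat).
Local Notation C := R[i].
Implicit Types (c : bits n -> R) (gamma beta : 'I_p -> R).

Lemma word_coef_real_complex gamma beta w0 :
  word_sum 6 (fun j => (gamma j)%:C) (fun j => (beta j)%:C) (fun w => (w == w0)%:R : C^o) =
  (word_coef gamma beta w0)%:C.
Proof.
rewrite /word_coef /word_sum rmorph_sum; apply: eq_bigr => f _.
rewrite rmorphM rmorph_prod rmorph_nat; congr (_ * _).
by apply: eq_bigr => j _; rewrite !rmorphM !rmorphXn !fmorphV !rmorph_nat.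
Qed.

(** The defaults of [head] and [last] are chosen so that the empty word, whose expectation is that
    of C, is not among the vanishing ones. *)
Lemma expect0_word_eq0 c w :
  [|| odd (size w), bool_of_gradient (head NablaC w)
    | ~~ bool_of_gradient (last Nabla w)] ->
  expect0 (iterated_commutator c w) = 0.
Proof.
case/or3P => [|w_head|]; first exact: expect0_odd.
  by case: w w_head => [//|[//|//] w] _; apply: expect0_nabla.
case/lastP: w => [//|w g]; rewrite last_rcons; case: g => // _.
exact: expect0_rcons.
Qed.

(** The words of length at most 5 are enumerated. Apart from the empty word, only cb and the four
    words c..b of length 4 survive, and the signs are i^2 = -1 and i^4 = 1. An abstract [E] keeps
    the commutators folded during the enumeration. *)
Lemma low_order_value (E : seq gradient -> C) w :
  (forall u, [|| odd (size u), bool_of_gradient (head NablaC u)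
    | ~~ bool_of_gradient (last Nabla u)] -> E u = 0) ->
  E [:: NablaC; Nabla; NablaC; Nabla] = E [:: NablaC; NablaC; Nabla; Nabla] ->
  (if (size w < 6)%N then 'i%C ^+ size w * E w else 0) =
  E [::] * (w == [::])%:R
  - E [:: NablaC; Nabla] * (w == [:: NablaC; Nabla])%:R
  + E [:: NablaC; Nabla; Nabla; Nabla] * (w == [:: NablaC; Nabla; Nabla; Nabla])%:R
  + E [:: NablaC; NablaC; NablaC; Nabla] * (w == [:: NablaC; NablaC; NablaC; Nabla])%:R
  + E [:: NablaC; NablaC; Nabla; Nabla] *
      ((w == [:: NablaC; NablaC; Nabla; Nabla])%:R +
       (w == [:: NablaC; Nabla; NablaC; Nabla])%:R).
Proof.
move=> E_eq0 E_swap.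
have i2 : 'i%C ^+ 2 = -1 :> C := sqr_i R.
have i4 : 'i%C ^+ 4 = 1 :> C by rewrite (exprM _ 2 2) i2 sqrrN expr1n.
case: ifPn => [w6|w6]; last first.
  have w_ne u : (size u < 6)%N -> (w == u) = false.
    by move=> u6; apply/negbTE; apply: contraNneq w6 => ->.
  by rewrite !w_ne // !(mulr0, addr0, subr0).
case: w w6 => [|g1 [|g2 [|g3 [|g4 [|g5 [|//]]]]]] _;
  do ?[case: g1]; do ?[case: g2]; do ?[case: g3]; do ?[case: g4]; do ?[case: g5];
  rewrite /= ?(mulr0, mulr1, addr0, add0r, subr0, sub0r, oppr0);
  first [by rewrite E_eq0 ?mulr0
        |by rewrite ?E_swap ?expr0 ?i2 ?i4 ?mul1r ?mulN1r].
Qed.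

Lemma low_order_sum c gamma beta :
  word_sum 6 (fun j => (gamma j)%:C) (fun j => (beta j)%:C)
    (fun w => if (size w < 6)%N then 'i%C ^+ size w * expect0 (iterated_commutator c w)
              else 0 : C^o) =
  expect0 (costH c)
  - expect0 (nablaC c (nabla (costH c))) * (word_coef gamma beta [:: NablaC; Nabla])%:C
  + expect0 (nablaC c (iter 3 (@nabla R n) (costH c))) *
      (word_coef gamma beta [:: NablaC; Nabla; Nabla; Nabla])%:C
  + expect0 (iter 3 (nablaC c) (nabla (costH c))) *
      (word_coef gamma beta [:: NablaC; NablaC; NablaC; Nabla])%:C
  + expect0 (iter 2 (nablaC c) (iter 2 (@nabla R n) (costH c))) *
      (word_coef gamma beta [:: NablaC; NablaC; Nabla; Nabla] +
       word_coef gamma beta [:: NablaC; Nabla; NablaC; Nabla])%:C.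
Proof.
pose E w := expect0 (iterated_commutator c w).
have E_swap : E [:: NablaC; Nabla; NablaC; Nabla] = E [:: NablaC; NablaC; Nabla; Nabla].
  by have := iterated_commutator_swap c [:: NablaC]; rewrite !cat1s /E => ->.
transitivity (E [::] * (word_coef gamma beta [::])%:C
  - E [:: NablaC; Nabla] * (word_coef gamma beta [:: NablaC; Nabla])%:C
  + E [:: NablaC; Nabla; Nabla; Nabla] * (word_coef gamma beta [:: NablaC; Nabla; Nabla; Nabla])%:C
  + E [:: NablaC; NablaC; NablaC; Nabla] *
      (word_coef gamma beta [:: NablaC; NablaC; NablaC; Nabla])%:C
  + E [:: NablaC; NablaC; Nabla; Nabla] *
      ((word_coef gamma beta [:: NablaC; NablaC; Nabla; Nabla])%:C +
       (word_coef gamma beta [:: NablaC; Nabla; NablaC; Nabla])%:C)); last first.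
  by rewrite word_coef_nil mulr1 rmorphD.
pose ind (u w : seq gradient) : C^o := (w == u)%:R.
have := @word_sum_comb C p 6 (fun j => (gamma j)%:C) (fun j => (beta j)%:C)
  (E [::]) (E [:: NablaC; Nabla]) (E [:: NablaC; Nabla; Nabla; Nabla])
  (E [:: NablaC; NablaC; NablaC; Nabla]) (E [:: NablaC; NablaC; Nabla; Nabla])
  (ind [::]) (ind [:: NablaC; Nabla]) (ind [:: NablaC; Nabla; Nabla; Nabla])
  (ind [:: NablaC; NablaC; NablaC; Nabla]) (ind [:: NablaC; NablaC; Nabla; Nabla])
  (ind [:: NablaC; Nabla; NablaC; Nabla]).
rewrite !word_coef_real_complex => <-; congr word_sum; apply/funext => w.
by rewrite -(low_order_value w (@expect0_word_eq0 c) E_swap).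
Qed.

End LowOrder.


Theorem theorem4p2p1 (R : realType) (n p : nat) (hp : (0 < p)%N) :
  exists a : ('I_p + 'I_p -> nat) -> gradient_comb R,
    (forall m : 'I_p + 'I_p -> nat, (mdegree m < 6)%N -> a m = [::]) /\
    (forall m : 'I_p + 'I_p -> nat,
       all (fun u => (6 <= size u.2)%N) (a m)) /\
    forall (c : bits n -> R) (gamma beta : 'I_p -> R),
      mpseries_sums_to (fun m => eval_comb c (a m)) (angles gamma beta)
        (qaoa_expectation c gamma beta -
         (expect0 (costH c)
          - expect0 (nablaC c (nabla (costH c))) *
            (\sum_(i < p) \sum_(j < p | (i <= j)%N) gamma i * beta j)%:C
          + expect0 (nablaC c (iter 3 (@nabla R n) (costH c))) *
            (\sum_(i < p) \sum_(j < p) \sum_(k < p)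
               \sum_(l < p | [&& i <= j, j < k & k < l]%N)
                 gamma i * beta j * beta k * beta l
             + 2^-1 * (\sum_(i < p) \sum_(j < p)
               \sum_(k < p | [&& i <= j & j < k]%N)
                 gamma i * (beta j ^+ 2 * beta k + beta j * beta k ^+ 2))
             + (3`!)%:R^-1 * (\sum_(i < p) \sum_(j < p | (i <= j)%N)
                 gamma i * beta j ^+ 3))%:C
          + expect0 (iter 3 (nablaC c) (nabla (costH c))) *
            (\sum_(i < p) \sum_(j < p) \sum_(k < p)
               \sum_(l < p | [&& i < j, j < k & k <= l]%N)
                 gamma i * gamma j * gamma k * beta l
             + 2^-1 * (\sum_(j < p) \sum_(k < p)
               \sum_(l < p | [&& j < k & k <= l]%N)
                 (gamma j ^+ 2 * gamma k + gamma j * gamma k ^+ 2) * beta l)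
             + (3`!)%:R^-1 * (\sum_(i < p) \sum_(j < p | (i <= j)%N)
                 gamma i ^+ 3 * beta j))%:C
          + expect0 (iter 2 (nablaC c) (iter 2 (@nabla R n) (costH c))) *
            (\sum_(i < p) \sum_(j < p) \sum_(k < p)
               \sum_(l < p | [&& i < j, j <= k & k < l]%N)
                 gamma i * gamma j * beta k * beta l
             + 2^-1 * (\sum_(i < p) \sum_(k < p)
               \sum_(l < p | [&& i <= k & k < l]%N)
                 gamma i ^+ 2 * beta k * beta l)
             + 2^-1 * (\sum_(i < p) \sum_(j < p)
               \sum_(k < p | [&& i < j & j <= k]%N)
                 gamma i * gamma j * beta k ^+ 2)
             + 4^-1 * (\sum_(i < p) \sum_(j < p | (i <= j)%N)
                 gamma i ^+ 2 * beta j ^+ 2)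
             + \sum_(i < p) \sum_(j < p) \sum_(k < p)
               \sum_(l < p | [&& i <= j, j < k & k <= l]%N)
                 gamma i * beta j * gamma k * beta l)%:C)).
Proof.
exists (@gradient_coef R p); split; [|split].
- by move=> m m6; rewrite /gradient_coef m6.
- move=> m; rewrite /gradient_coef; case: ltnP => //= m6.
  by rewrite size_multi_word m6.
move=> c gamma beta; rewrite (funext (eval_gradient_coef c)).
(* The subtracted partial sum, over degrees 0 to 5, is the explicit polynomial of the statement. *)
have := mpseries_drop 6 (full_coef_sums_to c gamma beta).
rewrite series_full_coef low_order_sum word_coef_cb_sum word_coef_cbbb_sum.
by rewrite word_coef_cccb_sum word_coef_ccbb_cbcb_sum.
Qed.
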